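(* Let $B\in\mathbb{R}^{d\times r}$ be an unknown matrix with orthonormal columns, and let $\theta_1,\dots,\theta_\tau\in\mathbb{R}^d$ be a sequence of tasks with $\theta_i=B\alpha_i$ for some $\alpha_i\in\mathbb{R}^r$ and $\phi_{\min}\le\|\theta_i\|\le\phi_{\max}$ for positive constants $\phi_{\min},\phi_{\max}$, where $\tau>r^2$. The tasks are played in order, each for $N$ rounds: during task $i$, at each round the agent chooses $x\in\mathcal A:=\{x\in\mathbb{R}^d:\|x\|\le1\}$ and observes $y=x^\top\theta_i+\eta$, with independent zero-mean $1$-sub-Gaussian noise. Assume there is $L=c_1r$ for a constant $c_1>0$ such that for every $s$, the matrix $W_s=[\theta_{s+1},\dots,\theta_{s+L}]$ satisfies $\sigma_r(W_sW_s^\top)\ge\nu>0$, where $\sigma_r$ is the $r$th largest singular value. The agent uses the Sequential Representation Learning (SeqRepL) algorithm: starting with $\hat P=0_{d\times d}$, in cycle $n=1,2,\dots$ it (i) plays the next $L$ tasks with the Representation Exploration (RE) algorithm, adding $\hat\theta_i\hat\theta_i^\top$ to $\hat P$ for each resulting estimate $\hat\theta_i$, and then sets $\hat B$ to the matrix of the top $r$ singular vectors of $\hat P$; (ii) plays the next $nL$ tasks with the Representation Transfer (RT) algorithm with input $\hat B$. Here, for a task played for $N$ rounds: RE takes, for $t=1,\dots,N_1=\lceil d\sqrt N\rceil$, $x_t=a_i$ with $i=((t-1)\bmod d)+1$ for an orthonormal basis $a_1,\dots,a_d$ of $\mathbb{R}^d$, computes $\hat\theta=(XX^\top)^{-1}XY$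 with $X=[x_1,\dots,x_{N_1}]$, $Y=[y_1,\dots,y_{N_1}]^\top$, and then takes $x_t=\arg\max_{x\in\mathcal A}x^\top\hat\theta$ for the remaining rounds; RT takes, for $t=1,\dots,N_2=\lceil r\sqrt N\rceil$, $x_t=a'_i$ with $i=((t-1)\bmod r)+1$ for an orthonormal basis $a'_1,\dots,a'_r$ of $\mathrm{span}(\hat B)$, computes $\hat\alpha=(\hat B^\top XX^\top\hat B)^{-1}\hat B^\top XY$ with $X=[x_1,\dots,x_{N_2}]$, $Y=[y_1,\dots,y_{N_2}]^\top$, sets $\hat\theta=\hat B\hat\alpha$, and takes $x_t=\arg\max_{x\in\mathcal A}x^\top\hat\theta$ for the remaining rounds. Then the total regret $R_{\tau N}=\sum_{i=1}^{\tau}\sum_{\text{rounds of task }i}(x_i^*-x_t)^\top\theta_i$, where $x_i^*\in\arg\max_{x\in\mathcal A}x^\top\theta_i$, satisfies $$\mathbb{E}R_{\tau N}=\tilde O\big(d\sqrt{\tau rN}+\tau r\sqrt N\big).$$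
   Context: $f=\tilde O(g)$ means $f=O(g\log^k(\cdot))$ for some $k$, i.e., up to logarithmic factors. The number $\tau$ of tasks is not known to the agent. *)

(* Defs.v *)
From HB Require Import structures.
From mathcomp Require Import all_boot all_order all_algebra.
From mathcomp Require Import all_classical all_reals all_analysis.
Set Implicit Arguments. Unset Strict Implicit. Unset Printing Implicit Defensive.
Import Order.TTheory GRing.Theory Num.Theory.
Local Open Scope ring_scope.
Local Open Scope classical_set_scope.

Section Defs.
Variable R : realType.

Definition dotv {d} (u v : 'cV[R]_d) : R := (u^T *m v) 0 0.
Definition vnorm {d} (v : 'cV[R]_d) : R := Num.sqrt (dotv v v).

(* the optimal action x* = argmax_{||x||<=1} x^T th = th/||th|| (th <> 0) *)
Definition opt_action {d} (th : 'cV[R]_d) : 'cV[R]_d := (vnorm th)^-1 *: th.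

Definition is_argmax_selector d (amax : 'cV[R]_d -> 'cV[R]_d) : Prop :=
  forall v, vnorm (amax v) <= 1 /\
            forall x : 'cV[R]_d, vnorm x <= 1 -> dotv x v <= dotv (amax v) v.

(* s is the multiset of eigenvalues of M^T M (squared singular values) *)
Definition sqsv_spec {m n} (M : 'M[R]_(m, n)) (s : seq R) : Prop :=
  char_poly (M^T *m M) = \prod_(x <- s) ('X - x%:P).
Definition sing_vals {m n} (M : 'M[R]_(m, n)) : seq R :=
  sort (fun x y => y <= x) [seq Num.sqrt x | x <- xget [::] (sqsv_spec M)].
Definition sigma {m n} (k : nat) (M : 'M[R]_(m, n)) : R :=
  nth 0 (sing_vals M) k.-1.

(* M's columns are orthonormal; column j is a right singular vector of P
   for the (j+1)-th largest singular value: "top r singular vectors of P" *)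
Definition top_sv_spec {d r} (P : 'M[R]_d) (M : 'M[R]_(d, r)) : Prop :=
  M^T *m M = 1%:M /\
  forall j : 'I_r, (P^T *m P) *m col j M = (sigma j.+1 P) ^+ 2 *: col j M.

Definition basis_spec {d r} (Bh Ab : 'M[R]_(d, r)) : Prop :=
  Ab^T *m Ab = 1%:M /\ (Ab^T == Bh^T)%MS.

Definition cyc_col {d m} (M : 'M[R]_(d, m)) (t : nat) : 'cV[R]_d :=
  \sum_(k < m | (k : nat) == (t %% m)%N) col k M.

Definition nexp (k N : nat) : nat := `|Num.ceil (k%:R * Num.sqrt (N%:R : R))|%N.

Definition explX {d m} (A : 'M[R]_(d, m)) (n : nat) : 'M[R]_(d, n) :=
  \matrix_(k, j) cyc_col A j k 0.

Definition obsY {d n} (X : 'M[R]_(d, n)) (th : 'cV[R]_d) (e : nat -> R)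
  : 'cV[R]_n := \col_j (dotv (col j X) th + e j).

Definition RE_est d N (A0 : 'M[R]_d) (th : 'cV[R]_d) (e : nat -> R)
  : 'cV[R]_d :=
  let X := explX A0 (nexp d N) in
  invmx (X *m X^T) *m X *m obsY X th e.
Definition RE_action d N (A0 : 'M[R]_d) (amax : 'cV[R]_d -> 'cV[R]_d)
  (th : 'cV[R]_d) (e : nat -> R) (t : nat) : 'cV[R]_d :=
  if (t < nexp d N)%N then cyc_col A0 t else amax (RE_est N A0 th e).

(* Representation Transfer, with input Bh and orthonormal basis Ab of span Bh *)
Definition RT_est d r N (Ab Bh : 'M[R]_(d, r)) (th : 'cV[R]_d) (e : nat -> R)
  : 'cV[R]_d :=
  let X := explX Ab (nexp r N) in
  Bh *m (invmx (Bh^T *m X *m X^T *m Bh) *m Bh^T *m X *m obsY X th e).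
Definition RT_action d r N (Ab Bh : 'M[R]_(d, r)) (amax : 'cV[R]_d -> 'cV[R]_d)
  (th : 'cV[R]_d) (e : nat -> R) (t : nat) : 'cV[R]_d :=
  if (t < nexp r N)%N then cyc_col Ab t else amax (RT_est N Ab Bh th e).

(* SeqRepL schedule: task i (0-based) is in cycle n (1-based) at position k
   (0-based); cycle n consists of L RE tasks followed by n*L RT tasks *)
Fixpoint sched (L i : nat) : nat * nat :=
  match i with
  | 0 => (1%N, 0%N)
  | i'.+1 => let: (n, k) := sched L i' in
             if (k.+1 < L + n * L)%N then (n, k.+1) else (n.+1, 0%N)
  end.
Definition is_RE (L i : nat) : bool := ((sched L i).2 < L)%N.

Fixpoint seq_state d r N L (A0 : 'M[R]_d) (topr : 'M[R]_d -> 'M[R]_(d, r))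
  (theta : nat -> 'cV[R]_d) (noise : nat -> nat -> R) (i : nat)
  : 'M[R]_d * 'M[R]_(d, r) :=
  match i with
  | 0 => (0, 0)
  | i'.+1 =>
    let: (P, Bh) := seq_state N L A0 topr theta noise i' in
    if is_RE L i' then
      let th := RE_est N A0 (theta i') (noise i') in
      let P' := P + th *m th^T in
      (P', if (sched L i').2 == L.-1 then topr P' else Bh)
    else (P, Bh)
  end.

Definition seq_action d r N L (A0 : 'M[R]_d) (topr : 'M[R]_d -> 'M[R]_(d, r))
  (basisRT : 'M[R]_(d, r) -> 'M[R]_(d, r)) (amax : 'cV[R]_d -> 'cV[R]_d)
  (theta : nat -> 'cV[R]_d) (noise : nat -> nat -> R) (i t : nat)
  : 'cV[R]_d :=
  let Bh := (seq_state N L A0 topr theta noise i).2 in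
  if is_RE L i then RE_action N A0 amax (theta i) (noise i) t
  else RT_action N (basisRT Bh) Bh amax (theta i) (noise i) t.

Definition regret d r (tau N L : nat) (A0 : 'M[R]_d)
  (topr : 'M[R]_d -> 'M[R]_(d, r)) (basisRT : 'M[R]_(d, r) -> 'M[R]_(d, r))
  (amax : 'cV[R]_d -> 'cV[R]_d) (theta : nat -> 'cV[R]_d)
  (noise : nat -> nat -> R) : R :=
  \sum_(i < tau) \sum_(t < N)
    (dotv (opt_action (theta i)) (theta i)
     - dotv (seq_action N L A0 topr basisRT amax theta noise i t) (theta i)).

(* W_s = [theta_{s+1}, ..., theta_{s+L}] (0-based: theta s, ..., theta (s+L-1)) *)
Definition Wmat d (theta : nat -> 'cV[R]_d) (s L : nat) : 'M[R]_(d, L) :=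
  \matrix_(k, j) theta (s + j)%N k 0.

Definition mutual_indep {dsp} {T : measurableType dsp} {I : eqType}
  (P : probability T R) (D : set I) (X : I -> T -> R) : Prop :=
  forall s : seq I, uniq s -> (forall j, j \in s -> D j) ->
  forall A : I -> set R, (forall j, measurable (A j)) ->
  P (\big[setI/setT]_(j <- s) (X j @^-1` A j)) =
  (\prod_(j <- s) P (X j @^-1` A j))%E.

Definition noise_model {dsp} {T : measurableType dsp} (P : probability T R)
  (tau N : nat) (eta : nat -> nat -> T -> R) : Prop :=
  (forall i t, (i < tau)%N -> (t < N)%N ->
     measurable_fun setT (eta i t) /\
     (\int[P]_w (eta i t w)%:E = 0)%E /\
     (forall lam : R,
        (\int[P]_w (expR (lam * eta i t w))%:E <= (expR (lam ^+ 2 / 2))%:E)%E)) /\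
  mutual_indep P [set ij | (ij.1 < tau)%N /\ (ij.2 < N)%N]
    (fun ij : nat * nat => eta ij.1 ij.2).

End Defs.

(* Main.v *)
Require Import Defs.
From HB Require Import structures.
From mathcomp Require Import all_boot all_order all_algebra.
From mathcomp Require Import all_classical all_reals all_analysis.
From mathcomp Require Import measurable_realfun complex ring lra zify.
Import Order.TTheory GRing.Theory Num.Theory.
Local Open Scope ring_scope.
Set Implicit Arguments. Unset Strict Implicit. Unset Printing Implicit Defensive.

(** The regret of an exploitation round is at most twice the squared estimation
    error divided by the norm of the task vector. For RE that error is pure
    averaged noise; for RT it splits orthogonally into averaged noise and the
    component of [theta_i] outside the span of [Bh].

    Let [Th] collect the task vectors of the RE phases of the first [n] cycles and [E]
    their estimation errors. The span of the top [r] singular vectors of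
    [(Th + E) (Th + E)^T] is compared with the span of [B]: for [x] orthogonal to
    the former, some vector of [span (Bh, x)] is orthogonal to the latter, which
    gives [|(Th + E)^T x| <= |E| |x|] and hence [|Th^T x| <= 2 |E| |x|]. Since
    [Th Th^T >= n nu] on [span B], the missed component of [theta_i] satisfies
    [|x|^2 <= 4 |E|^2 |theta_i|^2 / (n nu)]. A net argument bounds the mean of
    [|E|^2] by [(d + n L) / sqrt N] up to a logarithm, so an RT task of cycle [n]
    costs about [sqrt N (d / n + r)]. Finally [tau] tasks span about
    [sqrt (tau / r)] cycles. *)

(** Perturbing the Gram matrix [Th Th^T] directly, in the manner of Weyl or Davis-Kahan, would leave
    cross terms of size |Th| |E|. Comparing vectors through [(Th + E)^T] avoids them, asks neither
    for an eigengap nor for small noise, and bounds the squared missed component linearly in |E|^2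
    on every outcome. Hence no good event has to be set apart, and expectations are taken at once.

    The RT phase of cycle n has n L tasks because each pays about d sqrt N / n for its missed
    component: the phase then pays d L sqrt N, as much as the RE phase before it. Times the number
    of cycles this is the term d sqrt (tau r N). The term tau r sqrt N gathers what does not decay
    with n: exploration in dimension r, averaged noise inside the estimated span, and the n L noisy
    columns of [E], whose share n L / n stays at L.

    The single logarithm is the price of a net made of cubic grids, whose spacing shrinks with the
    dimension. *)

Section LinearAlgebra.
Context {R : realType}.

(** * Inner products and Cauchy-Schwarz *)

Lemma dotvE {d} (u v : 'cV[R]_d) : dotv u v = \sum_k u k 0 * v k 0.
Proof. by rewrite /dotv mxE; apply: eq_bigr => k _; rewrite mxE. Qed.

Lemma dotvC {d} (u v : 'cV[R]_d) : dotv u v = dotv v u.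
Proof. by rewrite !dotvE; apply: eq_bigr => k _; rewrite mulrC. Qed.

Lemma dotvDl {d} (u v w : 'cV[R]_d) : dotv (u + v) w = dotv u w + dotv v w.
Proof. by rewrite /dotv linearD mulmxDl mxE. Qed.

Lemma dotvDr {d} (u v w : 'cV[R]_d) : dotv w (u + v) = dotv w u + dotv w v.
Proof. by rewrite !(dotvC w) dotvDl. Qed.

Lemma dotvZl {d} a (u v : 'cV[R]_d) : dotv (a *: u) v = a * dotv u v.
Proof. by rewrite /dotv linearZ -scalemxAl mxE. Qed.

Lemma dotvZr {d} a (u v : 'cV[R]_d) : dotv u (a *: v) = a * dotv u v.
Proof. by rewrite dotvC dotvZl dotvC. Qed.

Lemma dotvNl {d} (u v : 'cV[R]_d) : dotv (- u) v = - dotv u v.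
Proof. by rewrite -scaleN1r dotvZl mulN1r. Qed.

Lemma dotvNr {d} (u v : 'cV[R]_d) : dotv u (- v) = - dotv u v.
Proof. by rewrite dotvC dotvNl dotvC. Qed.

Lemma dotv0l {d} (u : 'cV[R]_d) : dotv 0 u = 0.
Proof. by rewrite -(scale0r u) dotvZl mul0r. Qed.

Lemma dotv0r {d} (u : 'cV[R]_d) : dotv u 0 = 0.
Proof. by rewrite dotvC dotv0l. Qed.

Lemma dotv_ge0 {d} (u : 'cV[R]_d) : 0 <= dotv u u.
Proof. by rewrite dotvE sumr_ge0// => k _; rewrite -expr2 sqr_ge0. Qed.

Lemma dotv_eq0 {d} (u : 'cV[R]_d) : dotv u u = 0 -> u = 0.
Proof.
rewrite dotvE => /psumr_eq0P h; apply/matrixP => k l; rewrite (ord1 l) mxE.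
have := h (fun k _ => ltac:(rewrite -expr2; exact: sqr_ge0)) k isT.
by move=> /eqP; rewrite mulf_eq0 orbb => /eqP.
Qed.

Lemma dotv_mull {m n} (A : 'M[R]_(m, n)) u v :
  dotv (A *m u) v = dotv u (A^T *m v).
Proof. by rewrite /dotv trmx_mul mulmxA. Qed.

Lemma dotv_mulr {m n} (A : 'M[R]_(m, n)) u v :
  dotv u (A *m v) = dotv (A^T *m u) v.
Proof. by rewrite dotvC dotv_mull dotvC. Qed.

Lemma dotv_orth {m n} (A : 'M[R]_(m, n)) u v :
  A^T *m A = 1%:M -> dotv (A *m u) (A *m v) = dotv u v.
Proof. by move=> h; rewrite dotv_mull mulmxA h mul1mx. Qed.

Lemma vnorm_sqr {d} (v : 'cV[R]_d) : vnorm v ^+ 2 = dotv v v.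
Proof. by rewrite sqr_sqrtr ?dotv_ge0. Qed.

Lemma vnorm_ge0 {d} (v : 'cV[R]_d) : 0 <= vnorm v.
Proof. exact: sqrtr_ge0. Qed.

Lemma dotv_CS {d} (u v : 'cV[R]_d) :
  dotv u v ^+ 2 <= dotv u u * dotv v v.
Proof.
have [v0|vn0] := eqVneq (dotv v v) 0.
  by rewrite (dotv_eq0 v0) !dotv0r expr0n mulr0.
have vp : 0 < dotv v v by rewrite lt_neqAle eq_sym vn0 dotv_ge0.
have := dotv_ge0 (dotv v v *: u - dotv u v *: v).
rewrite !(dotvDl, dotvDr, dotvNl, dotvNr, dotvZl, dotvZr) (dotvC v u).
set a := dotv u u; set b := dotv u v; set c := dotv v v => h.
have h' : 0 <= c * (a * c - b ^+ 2).
  rewrite (_ : c * _ = c * (c * a) - c * (b * b)) //; last by ring.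
  by move: h; rewrite (_ : _ + _ = c * (c * a) - c * (b * b)); last by ring.
by move: h'; rewrite pmulr_rge0 // subr_ge0.
Qed.

Lemma vnorm_CS {d} (u v : 'cV[R]_d) : dotv u v <= vnorm u * vnorm v.
Proof.
rewrite (le_trans (ler_norm _))// -ler_sqr ?nnegrE ?mulr_ge0 ?vnorm_ge0//.
by rewrite real_normK ?num_real// exprMn !vnorm_sqr dotv_CS.
Qed.

(** * Spectral theorem for real symmetric matrices *)

Lemma complex_eigen_real_parts n (G : 'M[R]_n) (l : R[i]) (v : 'rV[R[i]]_n) :
  v *m map_mx (real_complex R) G = l *: v ->
  let v1 := map_mx (@complex.Re R) v in let v2 := map_mx (@complex.Im R) v in
  v1 *m G = complex.Re l *: v1 - complex.Im l *: v2 /\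
  v2 *m G = complex.Re l *: v2 + complex.Im l *: v1.
Proof.
move=> /matrixP h v1 v2.
split; apply/matrixP => i j; have := h i j; rewrite !mxE.
- move=> /(congr1 (@complex.Re R)); rewrite raddf_sum /=.
  case: l {h} => a b /=; case: (v i j) => c e /= <-.
  by apply: eq_bigr => k _; rewrite !mxE; case: (v i k) => x y /=; ring.
- move=> /(congr1 (@complex.Im R)); rewrite raddf_sum /=.
  case: l {h} => a b /=; case: (v i j) => c e /= <-.
  by apply: eq_bigr => k _; rewrite !mxE; case: (v i k) => x y /=; ring.
Qed.

(** Over [R[i]] the characteristic polynomial has a root a + ib, with eigenvector v1 + i v2. Moving
    [G] across the inner product of [G v1] with v2 gives b (|v1|^2 + |v2|^2) = 0, so the root is
    real and whichever of v1, v2 is nonzero is a real eigenvector. *)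
Lemma sym_eigen n (G : 'M[R]_n.+1) : G^T = G ->
  exists a (v : 'cV[R]_n.+1), G *m v = a *: v /\ dotv v v = 1.
Proof.
move=> Gs.
have /closed_rootP[l] : size (char_poly (map_mx (real_complex R) G)) != 1%N.
  by rewrite size_char_poly.
rewrite -eigenvalue_root_char => /eigenvalueP[v vG v0].
have /= := complex_eigen_real_parts vG.
set v1 := map_mx _ v; set v2 := map_mx _ v.
set a := complex.Re l; set b := complex.Im l => -[h1 h2].
have g1 : G *m v1^T = a *: v1^T - b *: v2^T.
  by rewrite -{1}Gs -trmx_mul h1 linearB /= !linearZ.
have g2 : G *m v2^T = a *: v2^T + b *: v1^T.
  by rewrite -{1}Gs -trmx_mul h2 linearD /= !linearZ.
have b0 : b * (dotv v1^T v1^T + dotv v2^T v2^T) = 0.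
  have : dotv (G *m v1^T) v2^T = dotv v1^T (G *m v2^T) by rewrite dotv_mull Gs.
  rewrite g1 g2 !(dotvDl, dotvDr, dotvNl, dotvNr, dotvZl, dotvZr) => h.
  lra.
have key (w : 'cV[R]_n.+1) : G *m w = a *: w -> dotv w w != 0 ->
    exists a (v : 'cV[R]_n.+1), G *m v = a *: v /\ dotv v v = 1.
  move=> hw w0; exists a, ((vnorm w)^-1 *: w); split.
    by rewrite -scalemxAr hw !scalerA mulrC.
  rewrite dotvZl dotvZr -vnorm_sqr.
  have : vnorm w != 0 by apply: contra_neq w0; rewrite -vnorm_sqr => ->; rewrite expr0n.
  by move=> ?; field.
have [e1|n1] := eqVneq (dotv v1^T v1^T) 0; last first.
  apply: (key v1^T) => //; rewrite g1.
  have p1 : 0 < dotv v1^T v1^T by rewrite lt_neqAle eq_sym n1 dotv_ge0.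
  have sp : 0 < dotv v1^T v1^T + dotv v2^T v2^T by rewrite ltr_wpDr // dotv_ge0.
  by move/eqP: b0; rewrite mulf_eq0 (gt_eqF sp) orbF => /eqP ->; rewrite scale0r subr0.
have [e2|n2] := eqVneq (dotv v2^T v2^T) 0; last first.
  apply: (key v2^T) => //; rewrite g2.
  have p2 : 0 < dotv v2^T v2^T by rewrite lt_neqAle eq_sym n2 dotv_ge0.
  have sp : 0 < dotv v1^T v1^T + dotv v2^T v2^T by rewrite ltr_wpDl // dotv_ge0.
  by move/eqP: b0; rewrite mulf_eq0 (gt_eqF sp) orbF => /eqP ->; rewrite scale0r addr0.
case/eqP: v0; apply/matrixP => i j; rewrite mxE.
have /matrixP/(_ j i) := dotv_eq0 e1; have /matrixP/(_ j i) := dotv_eq0 e2.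
by rewrite !mxE; case: (v i j) => x y /= -> ->.
Qed.

(** The reflection along [w = v - e] exchanges the unit vectors [v] and [e], because |v| = |e| = 1
    gives |w|^2 = 2 <w, v>. For [v = e] it degenerates to the identity. *)
Lemma householder n (v : 'cV[R]_n.+1) : dotv v v = 1 ->
  exists H : 'M[R]_n.+1, [/\ H^T = H, H *m H = 1%:M & H *m v = delta_mx 0 0].
Proof.
move=> v1; pose e : 'cV[R]_n.+1 := delta_mx 0 0; pose w := v - e.
have e1 : dotv e e = 1.
  rewrite dotvE (bigD1 ord0)//= !mxE /= big1 ?mulr1 ?addr0// => i i0.
  by rewrite !mxE (negbTE i0) mul0r.
have [w0|wn0] := eqVneq (dotv w w) 0.
  exists 1%:M; rewrite trmx1 !mul1mx; split=> //.
  by move/dotv_eq0/eqP: w0; rewrite subr_eq0 => /eqP.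
have ww : w^T *m w = (dotv w w)%:M.
  by rewrite [LHS]mx11_scalar.
have wv : w^T *m v = (dotv w v)%:M by rewrite [LHS]mx11_scalar.
exists (1%:M - (2 / dotv w w) *: (w *m w^T)); split.
- by rewrite linearB /= linearZ /= trmx_mul trmxK trmx1.
- set N := w *m w^T; set c := 2 / dotv w w.
  have NN : (c *: N) *m (c *: N) = c *: N + c *: N.
    rewrite -scalemxAl -scalemxAr /N mulmxA -(mulmxA w) ww mul_mx_scalar.
    rewrite -scalemxAl !scalerA -scalerDl; congr (_ *: _).
    by rewrite /c; field.
  by rewrite mulmxBl mul1mx mulmxBr mulmx1 NN opprB addrK addrNK.
- rewrite mulmxBl mul1mx -scalemxAl -mulmxA wv mul_mx_scalar scalerA.
  have -> : 2 / dotv w w * dotv w v = 1.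
    have -> : dotv w w = 2 * dotv w v; last first.
      have : dotv w v != 0.
        apply: contra_neq wn0 => h.
        move: h; rewrite /w !(dotvDl, dotvDr, dotvNl, dotvNr) v1 e1 (dotvC v e); lra.
      by move=> ?; field.
    by rewrite /w !(dotvDl, dotvDr, dotvNl, dotvNr) v1 e1 (dotvC v e); ring.
  by rewrite scale1r /w opprB addrC subrK.
Qed.

(** Deflation: a reflection [H] sending an eigenvector to the first basis vector makes the first
    column of [H G H] a multiple of that basis vector, by symmetry the first row too, and the
    induction hypothesis diagonalizes the remaining block. *)
Lemma spectral_sym n (G : 'M[R]_n) : G^T = G ->
  exists (Q : 'M[R]_n) (p : 'rV[R]_n),
    Q^T *m Q = 1%:M /\ G = Q^T *m diag_mx p *m Q.
Proof.
elim: n G => [|n IH] G Gs.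
  by exists 1%:M, 0; split; apply/matrixP => -[].
have [a [v [Gv v1]]] := sym_eigen Gs.
have [H [Hs HH Hv]] := householder v1.
have vH : v = H *m delta_mx 0 0 by rewrite -Hv mulmxA HH mul1mx.
have [G1 G1d] : exists G1 : 'M[R]_(1 + n), G1 = H *m G *m H by exists (H *m G *m H).
have G1s : G1^T = G1 by rewrite G1d !trmx_mul Hs Gs mulmxA.
have c0 (i : 'I_(1 + n)) : G1 i (lshift n 0) = a * (i == lshift n 0)%:R.
  have l0 : delta_mx (lshift n 0) 0 = delta_mx 0 0 :> 'cV[R]_(1 + n).
    by congr delta_mx; exact/val_inj.
  have : G1 *m (delta_mx (lshift n 0) 0 : 'cV_(1 + n)) = a *: delta_mx (lshift n 0) 0.
    by rewrite l0 G1d -!mulmxA -vH Gv -scalemxAr Hv.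
  by rewrite -colE => /matrixP/(_ i 0); rewrite !mxE => ->; rewrite eqxx andbT.
have G1E : G1 = block_mx a%:M 0 0 (drsubmx G1).
  rewrite -[LHS]submxK; congr block_mx.
  - by apply/matrixP => i j; rewrite !mxE (ord1 i) (ord1 j) /= c0 eqxx mulr1.
  - apply/matrixP => i j; rewrite -[in LHS]G1s !mxE (ord1 i) c0.
    by rewrite (_ : (_ == _) = false) ?mulr0//; apply/eqP => /(congr1 val).
  - apply/matrixP => i j; rewrite !mxE (ord1 j) c0.
    by rewrite (_ : (_ == _) = false) ?mulr0//; apply/eqP => /(congr1 val).
have [|Q' [p' [Q1 G'E]]] := IH (drsubmx G1).
  by rewrite trmx_drsub G1s.
pose K : 'M[R]_(1 + n) := block_mx 1%:M 0 0 Q'.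
have KK : K^T *m K = 1%:M.
  rewrite /K tr_block_mx mulmx_block trmx1 !trmx0 !(mul0mx, mulmx0, mul1mx, addr0, add0r).
  by rewrite Q1 -scalar_mx_block.
exists (K *m H), (row_mx (a%:M : 'rV_1) p' : 'rV[R]_(1 + n)); split.
  by rewrite trmx_mul mulmxA -(mulmxA H^T) KK mulmx1 Hs HH.
have {G'E} G1Q : G1 = K^T *m diag_mx (row_mx (a%:M : 'rV_1) p' : 'rV[R]_(1 + n)) *m K.
  rewrite G1E G'E diag_mx_row /K tr_block_mx !mulmx_block trmx1 !trmx0.
  rewrite !(mul0mx, mulmx0, mul1mx, mulmx1, addr0, add0r).
  by congr block_mx; apply/matrixP => i j; rewrite !mxE (ord1 i) (ord1 j) ?mxE.
have -> : G = H *m G1 *m H by rewrite G1d !mulmxA HH mul1mx -mulmxA HH mulmx1.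
by rewrite G1Q trmx_mul Hs !mulmxA.
Qed.

End LinearAlgebra.

(** * Singular values and top singular vectors of semidefinite matrices *)

Section SingularValues.
Context {R : realType}.

(** The eigenvectors are the rows of [Q], so [Q *m x] lists the coordinates of [x] in the
    eigenbasis. *)
Definition is_spectral {d} (P Q : 'M[R]_d) (p : 'rV[R]_d) : Prop :=
  Q^T *m Q = 1%:M /\ P = Q^T *m diag_mx p *m Q.

Lemma spectral_quad {d} (P Q : 'M[R]_d) p (x : 'cV[R]_d) : is_spectral P Q p ->
  dotv x (P *m x) = \sum_j p 0 j * (Q *m x) j 0 ^+ 2.
Proof.
move=> [_ ->]; rewrite -!mulmxA dotv_mulr trmxK dotvE.
by apply: eq_bigr => j _; rewrite mul_diag_mx [X in _ * X]mxE; ring.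
Qed.

Lemma spectral_norm {d} (P Q : 'M[R]_d) p (x : 'cV[R]_d) : is_spectral P Q p ->
  dotv x x = \sum_j (Q *m x) j 0 ^+ 2.
Proof.
move=> [QQ _]; rewrite -(dotv_orth x x QQ) dotvE.
by apply: eq_bigr => j _; rewrite expr2.
Qed.

Lemma spectral_ge0 {d} (P Q : 'M[R]_d) p : is_spectral P Q p ->
  (forall x, 0 <= dotv x (P *m x)) -> forall j, 0 <= p 0 j.
Proof.
move=> sp P0 j; have := P0 (Q^T *m delta_mx j 0).
rewrite (spectral_quad _ sp) mulmxA (mulmx1C sp.1) mul1mx.
rewrite (bigD1 j)//= big1 => [|i ij]; rewrite !mxE; first by rewrite eqxx addr0 expr1n mulr1.
by rewrite (negbTE ij) expr0n mulr0.
Qed.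

Lemma char_poly_orth_conj {d} (Q D : 'M[R]_d) : Q^T *m Q = 1%:M ->
  char_poly (Q^T *m D *m Q) = char_poly D.
Proof.
move=> QQ; rewrite /char_poly.
pose q := map_mx (@polyC R) Q; pose qt := map_mx (@polyC R) Q^T.
have qq : qt *m q = 1%:M by rewrite -map_mxM QQ map_mx1.
have -> : char_poly_mx (Q^T *m D *m Q) = qt *m char_poly_mx D *m q.
  rewrite /char_poly_mx mulmxBr mulmxBl !map_mxM -/q -/qt.
  by rewrite mul_mx_scalar -scalemxAl qq scalemx1.
by rewrite !det_mulmx mulrAC -det_mulmx qq det1 mul1r.
Qed.

(** [xget] returns some list of roots of the characteristic polynomial of P^T P; unique
    factorization makes it a permutation of the squared eigenvalues, and sorting removes the
    permutation. Nonnegativity turns the square roots back into the eigenvalues. *)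
Lemma sing_vals_psd {d} (P Q : 'M[R]_d) p : is_spectral P Q p ->
  (forall j, 0 <= p 0 j) ->
  sing_vals P = sort (fun x y => y <= x) [seq p 0 j | j <- enum 'I_d].
Proof.
move=> sp p0; have [QQ PE] := sp.
have cpE : char_poly (P^T *m P) =
    \prod_(x <- [seq p 0 j ^+ 2 | j <- enum 'I_d]) ('X - x%:P).
  have -> : P^T *m P = Q^T *m diag_mx (\row_j (p 0 j ^+ 2)) *m Q.
    rewrite PE !trmx_mul trmxK tr_diag_mx !mulmxA -(mulmxA _ Q) (mulmx1C QQ) mulmx1.
    congr (_ *m _); rewrite -mulmxA mulmx_diag; congr (_ *m diag_mx _).
  rewrite char_poly_orth_conj// char_poly_trig ?diag_mx_is_trig//.
  rewrite big_map big_enum /=; apply: eq_bigr => j _.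
  by rewrite !mxE eqxx mulr1n.
rewrite /sing_vals.
have : sqsv_spec P (xget [::] (sqsv_spec P)) by apply: xgetPex; eexists; exact: cpE.
rewrite {1}/sqsv_spec cpE => /prod_XsubC_eq; rewrite perm_sym => pe.
apply/perm_sortP.
- by move=> x y; exact: le_total.
- by move=> x y z h1 h2; exact: le_trans h2 h1.
- by move=> x y; rewrite andbC => /le_anti.
have := perm_map (@Num.sqrt R) pe; rewrite -map_comp => /perm_trans; apply.
by rewrite (eq_map (_ : _ =1 fun j => p 0 j))// => j /=; rewrite sqrtr_sqr ger0_norm.
Qed.

Lemma count_sorted_ge (s : seq R) k : sorted (fun x y => y <= x) s ->
  (k < size s)%N -> (k < count (fun x => (nth 0 s k <= x)%R) s)%N.
Proof.
move=> ss ks; rewrite -{2}(cat_take_drop k.+1 s) count_cat ltn_addr//.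
have ge_trans : transitive (fun x y : R => y <= x).
  by move=> y z t h1 h2; exact: le_trans h2 h1.
have /eqP -> : count (fun x => nth 0 s k <= x) (take k.+1 s) == size (take k.+1 s).
  rewrite -all_count; apply/(all_nthP 0) => i; rewrite size_takel// => ik.
  rewrite nth_take//.
  by apply: (sorted_leq_nth ge_trans _ 0 ss) => //; rewrite inE //; exact: leq_trans ik ks.
by rewrite size_takel.
Qed.

Lemma count_sorted_gt (s : seq R) k : sorted (fun x y => y <= x) s ->
  (k < size s)%N -> count (fun x => nth 0 s k < x) s =
  count (fun x => nth 0 s k < x) (take k s).
Proof.
move=> ss ks; rewrite -{2}(cat_take_drop k s) count_cat.
rewrite [X in (_ + X)%N](_ : _ = 0%N) ?addn0//; apply/eqP; rewrite -leqn0 leqNgt -has_count.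
have ge_trans : transitive (fun x y : R => y <= x).
  by move=> y z t h1 h2; exact: le_trans h2 h1.
rewrite -all_predC; apply/(all_nthP 0) => i; rewrite size_drop ltn_subRL => ik.
rewrite /= nth_drop -leNgt.
by apply: (sorted_leq_nth ge_trans _ 0 ss) => //; rewrite leq_addr.
Qed.

Lemma sing_vals_sorted {d} (P : 'M[R]_d) : sorted (fun x y => y <= x) (sing_vals P).
Proof. by apply: sort_sorted => x y; exact: le_total. Qed.

(** The order of the spectrum enters only through such counts, so the eigenvectors never have to be
    indexed by decreasing eigenvalue. *)
Lemma count_sing_vals {d} (P Q : 'M[R]_d) p (a : pred R) : is_spectral P Q p ->
  (forall j, 0 <= p 0 j) -> count a (sing_vals P) = #|[pred j | a (p 0 j)]|.
Proof.
move=> sp p0; rewrite (sing_vals_psd sp p0).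
rewrite (permP (_ : perm_eq _ [seq p 0 j | j <- enum 'I_d])) ?perm_sort//.
by rewrite count_map cardE size_filter enumT.
Qed.

Lemma size_sing_vals {d} (P Q : 'M[R]_d) p : is_spectral P Q p ->
  (forall j, 0 <= p 0 j) -> size (sing_vals P) = d.
Proof.
by move=> sp p0; rewrite (sing_vals_psd sp p0) size_sort size_map size_enum_ord.
Qed.

Lemma orth_entries_sum {d r} (T : 'M[R]_(d, r)) : T^T *m T = 1%:M ->
  \sum_j \sum_l T j l ^+ 2 = r%:R.
Proof.
move=> TT; rewrite exchange_big /=.
rewrite (eq_bigr (fun=> 1)) => [|l _]; first by rewrite sumr_const card_ord.
have /matrixP/(_ l l) := TT; rewrite !mxE eqxx mulr1n => <-.
by apply: eq_bigr => j _; rewrite !mxE expr2.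
Qed.

(* The eigenvectors with eigenvalue at least [nu] lie in the span of [B] and
   there are at least [r] of them, so by counting traces they span it. *)
Lemma sigma_lower {d r} (P : 'M[R]_d) (B : 'M[R]_(d, r)) nu (z : 'cV[R]_r) :
  P^T = P -> (forall x, 0 <= dotv x (P *m x)) -> B^T *m B = 1%:M ->
  B *m B^T *m P = P -> 0 < nu -> (0 < r)%N -> nu <= sigma r P ->
  nu * dotv z z <= dotv (B *m z) (P *m (B *m z)).
Proof.
move=> Ps P0 BB BP nu0 r0 sr.
have [Q [p sp]] := spectral_sym Ps; have p0 := spectral_ge0 sp P0.
have [QQ PE] := sp; have QQ' := mulmx1C QQ.
pose J := [pred j | nu <= p 0 j].
have Jr : (r <= #|J|)%N.
  (* [sigma] reads 0 beyond the end of the list, which [nu > 0] excludes. *)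
  have sz : (r.-1 < size (sing_vals P))%N.
    rewrite ltnNge; apply/negP => h; move: sr; rewrite /sigma nth_default//.
    by rewrite leNgt nu0.
  rewrite -(count_sing_vals (fun x => nu <= x) sp p0) -(prednK r0).
  apply: leq_trans (count_sorted_ge (sing_vals_sorted P) sz) _.
  by apply: sub_count => x /= h; apply: le_trans h; exact: sr.
pose T := Q *m B.
have TT : T^T *m T = 1%:M by rewrite trmx_mul mulmxA -(mulmxA B^T) QQ mulmx1.
(* [B *m B^T] fixes the range of [P], so in eigencoordinates the projection T T^T fixes every axis
   with nonzero eigenvalue, and its diagonal entry there is 1. *)
have TD : T *m T^T *m diag_mx p = diag_mx p.
  have -> : diag_mx p = Q *m P *m Q^T.
    by rewrite PE !mulmxA QQ' mul1mx -mulmxA QQ' mulmx1.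
  by rewrite trmx_mul !mulmxA -(mulmxA _ Q^T) QQ mulmx1 -[RHS]mulmxA -{2}BP !mulmxA.
have rowJ j : j \in J -> \sum_l T j l ^+ 2 = 1.
  rewrite inE => pj; have pj0 : p 0 j != 0 by rewrite gt_eqF // (lt_le_trans nu0).
  have := congr1 (fun A : 'M[R]_d => A j j) TD.
  rewrite mul_mx_diag !mxE eqxx mulr1n => h; apply: (mulIf pj0).
  rewrite mul1r -[RHS]h; congr (_ * _).
  by apply: eq_bigr => l _; rewrite !mxE expr2.
have rowN j : j \notin J -> forall l, T j l = 0.
  have h0 : \sum_(j | j \notin J) \sum_l T j l ^+ 2 = 0.
    apply/eqP; rewrite eq_le; apply/andP; split; last first.
      by apply: sumr_ge0 => i _; apply: sumr_ge0 => l _; exact: sqr_ge0.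
    have := orth_entries_sum TT; rewrite (bigID (mem J)) /= (eq_bigr _ rowJ).
    rewrite sumr_const -[1 *+ _]/(_%:R) => h.
    have : (r%:R : R) <= #|J|%:R by rewrite ler_nat.
    move: h; set a := \sum_(i | _) _; set x := r%:R; set y := #|_|%:R.
    by lra.
  move=> jJ l.
  have h : \sum_l T j l ^+ 2 = 0.
    apply: (psumr_eq0P _ h0) => // i _.
    by apply: sumr_ge0 => k _; exact: sqr_ge0.
  have /eqP : T j l ^+ 2 = 0 by apply: (psumr_eq0P _ h) => // i _; exact: sqr_ge0.
  by rewrite sqrf_eq0 => /eqP.
rewrite (spectral_quad _ sp) mulmxA -/T.
rewrite -(dotv_orth z z BB) (spectral_norm _ sp) mulmxA -/T mulr_sumr.
apply: ler_sum => j _; have [jJ|jJ] := boolP (j \in J).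
  by apply: ler_wpM2r; rewrite ?sqr_ge0.
rewrite (_ : (T *m z) j 0 = 0) ?expr0n ?mulr0//.
by rewrite mxE big1// => l _; rewrite rowN// mul0r.
Qed.

Lemma bessel {d r} (M : 'M[R]_(d, r)) (q : 'cV[R]_d) : M^T *m M = 1%:M ->
  dotv (q - M *m (M^T *m q)) (q - M *m (M^T *m q)) = dotv q q - dotv (M^T *m q) (M^T *m q).
Proof.
move=> MM; rewrite !(dotvDl, dotvDr, dotvNl, dotvNr) (dotv_orth _ _ MM).
rewrite dotv_mulr (dotv_mull M (M^T *m q) q); ring.
Qed.

(** [top_sv_spec] speaks of P^2 and sigma^2. For semidefinite [P] the equation p_j^2 t = sigma^2 t
    factors through p_j + sigma, a sum of nonnegative numbers, which leaves p_j t = sigma t. *)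
Lemma top_sv_eigen {d r} (P : 'M[R]_d) (M : 'M[R]_(d, r)) :
  P^T = P -> (forall x, 0 <= dotv x (P *m x)) -> top_sv_spec P M ->
  forall l : 'I_r, 0 <= sigma l.+1 P /\ P *m col l M = sigma l.+1 P *: col l M.
Proof.
move=> Ps P0 [MM ev] l.
have [Q [p sp]] := spectral_sym Ps; have p0 := spectral_ge0 sp P0.
have [QQ PE] := sp; have QQ' := mulmx1C QQ.
have s0 : 0 <= sigma l.+1 P.
  rewrite /sigma /=; have [h|h] := ltnP l (size (sing_vals P)); last by rewrite nth_default.
  have := mem_nth 0 h; rewrite {2}(sing_vals_psd sp p0) mem_sort.
  by move=> /mapP[j _ ->].
split => //.
have QP (x : 'cV[R]_d) : Q *m (P *m x) = diag_mx p *m (Q *m x).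
  by rewrite PE !mulmxA QQ' mul1mx.
suff : Q *m (P *m col l M) = Q *m (sigma l.+1 P *: col l M).
  by move=> /(congr1 (mulmx Q^T)); rewrite !mulmxA QQ !mul1mx.
have := congr1 (mulmx Q) (ev l); rewrite Ps -mulmxA !QP -!scalemxAr => /matrixP h.
apply/matrixP => j k; have := h j k.
rewrite !mul_diag_mx !mxE => {}h.
set t := \sum_(_ < _) _ in h *; set s := sigma _ _ in h s0 *.
have : (p 0 j + s) * ((p 0 j - s) * t) = 0.
  have -> : (p 0 j + s) * ((p 0 j - s) * t) = p 0 j * (p 0 j * t) - s ^+ 2 * t by ring.
  by rewrite h subrr.
move/eqP; rewrite mulf_eq0 => /orP[|/eqP h2]; last by apply/eqP; rewrite -subr_eq0 -mulrBl h2.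
rewrite paddr_eq0 // => /andP[/eqP -> /eqP ->] //.
Qed.

(** [top_sv_spec] does not say outright that [M] exhausts the large eigenspaces; counting does. Fix
    a singular value c attached to one column. The columns of T = Q M with singular value above c
    are unit vectors supported on the set [J] of eigenvalues above c, and there are at least #|J| of
    them. As each row of T has mass at most 1, the rows in [J] have mass exactly 1: those
    eigenvectors lie in the span of [M], hence are orthogonal to [x]. *)
Lemma top_sv_complement {d r} (P : 'M[R]_d) (M : 'M[R]_(d, r)) (x : 'cV[R]_d) :
  P^T = P -> (forall x, 0 <= dotv x (P *m x)) -> top_sv_spec P M ->
  M^T *m x = 0 ->
  forall l : 'I_r, dotv x (P *m x) <= sigma l.+1 P * dotv x x.
Proof.
move=> Ps P0 tM Mx l0.
have [Q [p sp]] := spectral_sym Ps; have p0 := spectral_ge0 sp P0.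
have [QQ PE] := sp; have QQ' := mulmx1C QQ.
have [MM _] := tM; have tE := top_sv_eigen Ps P0 tM.
set c := sigma l0.+1 P.
pose T := Q *m M.
have TT : T^T *m T = 1%:M by rewrite trmx_mul mulmxA -(mulmxA M^T) QQ mulmx1.
have TN (l : 'I_r) j : p 0 j != sigma l.+1 P -> T j l = 0.
  have QP : Q *m P = diag_mx p *m Q by rewrite PE !mulmxA QQ' mul1mx.
  have /(congr1 (mulmx Q)) := (tE l).2.
  have QM : Q *m col l M = col l T by rewrite !colE mulmxA.
  rewrite mulmxA QP -scalemxAr -mulmxA QM => /matrixP/(_ j 0).
  rewrite mul_diag_mx mxE [col l T j 0]mxE [RHS]mxE [col l T j 0]mxE => h ne; apply/eqP.
  have /eqP : (p 0 j - sigma l.+1 P) * T j l = 0 by rewrite mulrBl h subrr.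
  by rewrite mulf_eq0 subr_eq0 (negbTE ne).
have rd : (r <= d)%N.
  have : (\rank (1%:M : 'M[R]_r) <= d)%N.
    by rewrite -MM (leq_trans (mxrankM_maxr _ _)) // rank_leq_row.
  by rewrite mxrank1.
pose J := [pred j | c < p 0 j]; pose L' := [pred l : 'I_r | c < sigma l.+1 P].
(* In the sorted list the values above entry [l0] sit before it, hence at indices below r, where
   each is some [sigma l.+1 P]. *)
have JL : (#|J| <= #|L'|)%N.
  rewrite -(count_sing_vals (fun x => c < x) sp p0).
  have l0d : (l0 < size (sing_vals P))%N by rewrite (size_sing_vals sp p0) (leq_trans (ltn_ord l0)).
  rewrite /c /sigma /= (count_sorted_gt (sing_vals_sorted P) l0d).
  set t := take _ _.
  have tsz : size t = l0 by rewrite /t size_takel // ltnW.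
  rewrite -(mkseq_nth 0 t) tsz count_map.
  rewrite cardE -(size_map val) /=.
  rewrite -size_filter uniq_leq_size ?filter_uniq ?iota_uniq// => k.
  rewrite mem_filter mem_iota add0n /= => /andP[h kl].
  have kr : (k < r)%N by exact: ltn_trans kl (ltn_ord l0).
  apply/mapP; exists (Ordinal kr) => //.
  by rewrite mem_enum inE /c /sigma /=; move: h; rewrite /t nth_take.
have rowle j : \sum_l T j l ^+ 2 <= 1.
  pose q := Q^T *m (delta_mx j 0 : 'cV_d).
  have <- : dotv q q = 1.
    rewrite dotv_orth ?trmxK// dotvE (bigD1 j)//= big1 => [|i ij]; rewrite !mxE.
      by rewrite eqxx mulr1 addr0.
    by rewrite (negbTE ij) mul0r.
  have -> : \sum_l T j l ^+ 2 = dotv (M^T *m q) (M^T *m q).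
    rewrite dotvE; apply: eq_bigr => l _; rewrite -expr2; congr (_ ^+ 2).
    by rewrite /q mulmxA -trmx_mul -/T -colE !mxE.
  by rewrite -subr_ge0 -bessel// dotv_ge0.
have rowJ j : j \in J -> \sum_l T j l ^+ 2 = 1.
  suff h0 : \sum_(j in J) (1 - \sum_l T j l ^+ 2) <= 0.
    have {h0} : \sum_(j in J) (1 - \sum_l T j l ^+ 2) = 0.
      by apply/eqP; rewrite eq_le h0 sumr_ge0 // => i _; rewrite subr_ge0.
    move=> h0 jJ; apply/eqP; rewrite eq_sym -subr_eq0; apply/eqP.
    by apply: (psumr_eq0P _ h0) => // i _; rewrite subr_ge0.
  rewrite sumrB sumr_const subr_le0 -[1 *+ _]/(_%:R).
  apply: (@le_trans _ _ #|L'|%:R); first by rewrite ler_nat.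
  apply: (@le_trans _ _ (\sum_(j in J) \sum_(l in L') T j l ^+ 2)); last first.
    apply: ler_sum => i _; rewrite [leRHS](bigID (mem L')) /= lerDl.
    by apply: sumr_ge0 => l _; exact: sqr_ge0.
  rewrite exchange_big /= -[#|L'|%:R]/(1 *+ _) -sumr_const; apply: ler_sum => l lL.
  have /matrixP/(_ l l) := TT; rewrite !mxE eqxx mulr1n => <-.
  rewrite (bigID (mem J)) /= [X in _ + X]big1 ?addr0.
    by apply: ler_sum => k _; rewrite !mxE expr2.
  move=> k; rewrite inE -leNgt => jc; rewrite TN ?mulr0//.
  by move: lL; rewrite inE => lL; rewrite lt_eqF // (le_lt_trans jc).
have xJ j : j \in J -> (Q *m x) j 0 = 0.
  move=> jJ; pose q := Q^T *m (delta_mx j 0 : 'cV_d).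
  have -> : (Q *m x) j 0 = dotv q x.
    by rewrite /q dotv_mull trmxK dotvC dotvE (bigD1 j)//= big1 ?mxE ?eqxx ?mulr1 ?addr0// => i ij; rewrite [X in _ * X]mxE (negbTE ij) mulr0.
  have qE : q = M *m (M^T *m q).
    apply/eqP; rewrite -subr_eq0; apply/eqP/dotv_eq0; rewrite bessel//.
    have -> : dotv q q = 1.
      rewrite dotv_orth ?trmxK// dotvE (bigD1 j)//= big1 => [|i ij]; rewrite !mxE.
        by rewrite eqxx mulr1 addr0.
      by rewrite (negbTE ij) mul0r.
    rewrite -(rowJ _ jJ); apply/eqP; rewrite subr_eq0; apply/eqP.
    rewrite dotvE; apply: eq_bigr => l _; rewrite -expr2; congr (_ ^+ 2).
    by rewrite /q mulmxA -trmx_mul -/T -colE !mxE.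
  by rewrite qE dotv_mull Mx dotv0r.
rewrite (spectral_quad _ sp) (spectral_norm _ sp) mulr_sumr.
apply: ler_sum => j _; have [jJ|jJ] := boolP (j \in J).
  by rewrite xJ// expr0n !mulr0.
by apply: ler_wpM2r; rewrite ?sqr_ge0//; move: jJ; rewrite inE -leNgt.
Qed.

End SingularValues.

(** * Deterministic perturbation of the estimated span *)

Section Perturbation.
Context {R : realType}.

(** One half of Courant-Fischer on the span of [Bh] and [x]. There P has no cross term between [Bh]
    and [x], because [Bh] is invariant, and its eigenvalues on [Bh] are at least the Rayleigh
    quotient [rho] of [x], so [rho] is the minimum. At a vector [y] with B^T y = 0 the form of P
    reduces to |E^T y|^2, whence rho <= kappa. *)
Lemma top_sv_residual {d r M} (Th E : 'M[R]_(d, M)) (B Bh : 'M[R]_(d, r)) kappa x :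
  B^T *m B = 1%:M -> B *m B^T *m Th = Th ->
  top_sv_spec ((Th + E) *m (Th + E)^T) Bh ->
  (forall y, dotv (E^T *m y) (E^T *m y) <= kappa * dotv y y) ->
  Bh^T *m x = 0 ->
  dotv ((Th + E)^T *m x) ((Th + E)^T *m x) <= kappa * dotv x x.
Proof.
move=> BB BTh tB Ek Bx; set P := _ *m _ in tB.
have [x0|x0] := eqVneq x 0; first by rewrite x0 mulmx0 !dotv0l mulr0.
have xp : 0 < dotv x x.
  by rewrite lt_neqAle dotv_ge0 andbT eq_sym; apply: contra_neq x0; exact: dotv_eq0.
have PE y : dotv y (P *m y) = dotv ((Th + E)^T *m y) ((Th + E)^T *m y).
  by rewrite /P -mulmxA dotv_mulr.
have Ps : P^T = P by rewrite /P trmx_mul trmxK.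
have P0 y : 0 <= dotv y (P *m y) by rewrite PE dotv_ge0.
have tE := top_sv_eigen Ps P0 tB; have tC := top_sv_complement Ps P0 tB Bx.
have [MM _] := tB.
pose s : 'rV[R]_r := \row_l sigma l.+1 P.
have PB : P *m Bh = Bh *m diag_mx s.
  apply/matrixP => i l; have := congr1 (fun A : 'cV[R]_d => A i 0) (tE l).2.
  have -> : P *m col l Bh = col l (P *m Bh) by rewrite !colE mulmxA.
  by rewrite mul_mx_diag ![col _ _ _ _]mxE => ->; rewrite !mxE mulrC.
pose V : 'M[R]_(d, r + 1) := row_mx Bh x.
(* Coefficients of [y] in terms of [Bh] and [x]: r + 1 unknowns against the r equations B^T y =
   0. *)
have [c cV c0] : exists2 c : 'rV[R]_(r + 1), c *m (V^T *m B) = 0 & c != 0.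
  have : kermx (V^T *m B) != 0.
    by rewrite -mxrank_eq0 mxrank_ker subn_eq0 -ltnNge (leq_ltn_trans (rank_leq_col _))// addn1.
  by move=> /rowV0Pn[c /sub_kermxP]; exists c.
pose c1 : 'cV[R]_r := (lsubmx c)^T; pose a := rsubmx c 0 0.
pose y := Bh *m c1 + a *: x.
have yV : y = V *m c^T.
  rewrite -[c in RHS]hsubmxK tr_row_mx mul_row_col; congr (_ + _).
  by rewrite [rsubmx c]mx11_scalar tr_scalar_mx mul_mx_scalar.
have By : B^T *m y = 0.
  by rewrite yV mulmxA -[RHS]trmx0 -cV !trmx_mul trmxK.
have xBh : dotv (Bh *m c1) x = 0 by rewrite dotv_mull Bx dotv0r.
have yy : dotv y y = dotv c1 c1 + a ^+ 2 * dotv x x.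
  rewrite /y !(dotvDl, dotvDr, dotvZl, dotvZr) (dotv_orth _ _ MM) (dotvC x) xBh; ring.
have yPy : dotv y (P *m y) = dotv c1 (diag_mx s *m c1) + a ^+ 2 * dotv x (P *m x).
  have BhPx : dotv (Bh *m c1) (P *m x) = 0.
    rewrite dotv_mull mulmxA -Ps -trmx_mul PB trmx_mul -mulmxA Bx mulmx0.
    exact: dotv0r.
  have xBc : dotv x (Bh *m (diag_mx s *m c1)) = 0 by rewrite dotv_mulr Bx dotv0l.
  rewrite /y mulmxDr mulmxA PB -scalemxAr -mulmxA.
  rewrite !(dotvDl, dotvDr, dotvZl, dotvZr) (dotv_orth _ _ MM) BhPx xBc; ring.
set rho := dotv x (P *m x) / dotv x x.
have rhoE : dotv x (P *m x) = rho * dotv x x by rewrite /rho divfK // gt_eqF.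
have low : rho * dotv y y <= dotv y (P *m y).
  rewrite yy yPy rhoE mulrDr mulrCA lerD2r !dotvE mulr_sumr; apply: ler_sum => l _.
  have -> : (diag_mx s *m c1) l 0 = sigma l.+1 P * c1 l 0.
    by rewrite mul_diag_mx mxE [s _ _]mxE.
  rewrite [leRHS]mulrCA -expr2; apply: ler_wpM2r; first exact: sqr_ge0.
  by rewrite /rho ler_pdivrMr.
have up : dotv y (P *m y) <= kappa * dotv y y.
  rewrite PE; suff -> : (Th + E)^T *m y = E^T *m y by exact: Ek.
  rewrite [(_ + _)^T]linearD /= mulmxDl -[in Th^T]BTh !trmx_mul trmxK -!mulmxA By.
  by rewrite !mulmx0 add0r.
have yp : 0 < dotv y y.
  rewrite lt_neqAle dotv_ge0 andbT eq_sym; apply: contra_neq c0 => yy0.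
  have := dotv_ge0 c1; have a2 := sqr_ge0 a; have := mulr_ge0 a2 (ltW xp) => h1 h2.
  have ca : dotv c1 c1 = 0 by move: yy0; rewrite yy; lra.
  have aa : a ^+ 2 * dotv x x = 0 by move: yy0; rewrite yy; lra.
  move/eqP: aa; rewrite mulf_eq0 (gt_eqF xp) orbF sqrf_eq0 => /eqP aa.
  rewrite -[c]hsubmxK [rsubmx c]mx11_scalar -/a aa -[lsubmx c]trmxK -/c1 (dotv_eq0 ca).
  by rewrite trmx0 raddf0 row_mx0.
rewrite -PE rhoE ler_pM2r// -(ler_pM2r yp).
exact: le_trans low up.
Qed.

(** As [x] is orthogonal to [Bh] and [th = B alpha], |x|^2 = <B^T x, alpha>. The lower bound [mu]
    controls |B^T x| by |Th^T x|, and Cauchy-Schwarz then bounds |x|^4 by a multiple of |x|^2, which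
    is cancelled. The 4 comes from |u - v|^2 <= 2 |u|^2 + 2 |v|^2 with |u|^2 and |v|^2 at most kappa
    |x|^2. *)
Lemma projection_error {d r M} (Th E : 'M[R]_(d, M)) (B Bh : 'M[R]_(d, r))
    kappa mu (alpha : 'cV[R]_r) (th := B *m alpha) (x := th - Bh *m (Bh^T *m th)) :
  B^T *m B = 1%:M -> B *m B^T *m Th = Th ->
  top_sv_spec ((Th + E) *m (Th + E)^T) Bh ->
  (forall y, dotv (E^T *m y) (E^T *m y) <= kappa * dotv y y) ->
  0 < mu ->
  (forall z, mu * dotv z z <= dotv (Th^T *m (B *m z)) (Th^T *m (B *m z))) ->
  dotv x x <= 4 * kappa * dotv th th / mu.
Proof.
move=> BB BTh tB Ek mu0 Thmu; have [MM _] := tB.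
have Bx : Bh^T *m x = 0 by rewrite /x mulmxBr (mulmxA Bh^T Bh) MM mul1mx subrr.
have h1 := top_sv_residual BB BTh tB Ek Bx.
have [x0|x0] := eqVneq (dotv x x) 0.
  rewrite x0; apply: divr_ge0 (ltW mu0); rewrite -mulrA; apply: mulr_ge0 => //.
  exact: le_trans (dotv_ge0 _) (Ek th).
have xp : 0 < dotv x x by rewrite lt_neqAle dotv_ge0 andbT eq_sym.
have xth : dotv x x = dotv (B^T *m x) alpha.
  rewrite {2}/x dotvDr dotvNr (dotv_mulr Bh) Bx dotv0l subr0 /th dotv_mulr //.
have ThB : Th^T *m x = Th^T *m (B *m (B^T *m x)).
  by rewrite -[in LHS]BTh !trmx_mul trmxK -!mulmxA.
have h2 : mu * dotv (B^T *m x) (B^T *m x) <= 4 * kappa * dotv x x.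
  apply: le_trans (Thmu _) _; rewrite -ThB.
  have -> : Th^T *m x = (Th + E)^T *m x - E^T *m x.
    by rewrite [(_ + _)^T]linearD /= mulmxDl addrK.
  have h3 := Ek x; move: h1 h3; move: (dotv x x) => X.
  move: ((Th + E)^T *m x) (E^T *m x) => u v h1 h3; have := dotv_ge0 (u + v).
  rewrite !(dotvDl, dotvDr, dotvNl, dotvNr) (dotvC v u).
  by lra.
have cs := dotv_CS (B^T *m x) alpha; rewrite -xth in cs.
rewrite ler_pdivlMr// -(ler_pM2r xp).
have -> : dotv th th = dotv alpha alpha by rewrite /th (dotv_orth _ _ BB).
have := ler_wpM2r (dotv_ge0 alpha) h2; have := ler_wpM2l (ltW mu0) cs.
set X := dotv x x; set b := dotv (_ *m _) _; set al := dotv alpha alpha => g1 g2.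
rewrite [leLHS](_ : _ = mu * X ^+ 2); last by ring.
apply: le_trans g1 _; rewrite mulrA; apply: le_trans g2 _.
by rewrite le_eqVlt; apply/orP; left; apply/eqP; ring.
Qed.

(** * Regret of a single round *)

Lemma opt_action_value {d} (th : 'cV[R]_d) : 0 < vnorm th ->
  dotv (opt_action th) th = vnorm th.
Proof. by move=> h; rewrite /opt_action dotvZl -vnorm_sqr expr2 mulKf ?gt_eqF. Qed.

Lemma explore_gap {d} (th a : 'cV[R]_d) : 0 < vnorm th -> vnorm a <= 1 ->
  dotv (opt_action th) th - dotv a th <= 2 * vnorm th.
Proof.
move=> h a1; rewrite opt_action_value//.
have := vnorm_CS (- a) th; rewrite dotvNl.
have -> : vnorm (- a) = vnorm a by rewrite /vnorm dotvNl dotvNr opprK.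
have := ler_wpM2r (ltW h) a1; rewrite mul1r => g1 g2; lra.
Qed.

(* The gap [g] satisfies [g <= |a - th/|th|| |v - th|] by optimality of [a] at
   [v], and [|a - th/|th||^2 <= 2 g / |th|]. *)
Lemma argmax_gap {d} (amax : 'cV[R]_d -> 'cV[R]_d) (th v : 'cV[R]_d) :
  is_argmax_selector amax -> 0 < vnorm th ->
  dotv (opt_action th) th - dotv (amax v) th
    <= 2 * dotv (v - th) (v - th) / vnorm th.
Proof.
move=> am h; have [a1 aopt] := am v; set a := amax v in a1 aopt *.
have uu : dotv (opt_action th) (opt_action th) = 1.
  rewrite /opt_action dotvZr -/(opt_action th) opt_action_value// mulVf// gt_eqF//.
set u := opt_action th in uu *.
have u1 : vnorm u <= 1 by rewrite /vnorm uu sqrtr1.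
have thu : th = vnorm th *: u by rewrite /u /opt_action scalerA divff ?gt_eqF// scale1r.
have g1 := aopt u u1.
clearbody u.
set g := dotv u th - dotv a th.
have au : dotv (a - u) (a - u) * vnorm th <= 2 * g.
  have aa : dotv a a <= 1.
    by rewrite -vnorm_sqr expr_le1// vnorm_ge0.
  have gE : g = vnorm th * (1 - dotv a u).
    by rewrite /g [in LHS]thu !dotvZr uu; ring.
  rewrite gE mulrC mulrCA ler_pM2l// !(dotvDl, dotvDr, dotvNl, dotvNr) uu (dotvC u a); lra.
have ge : g <= dotv (a - u) (v - th).
  rewrite /g !(dotvDl, dotvDr, dotvNl, dotvNr); lra.
have [g0|g0] := leP g 0.
  by apply: le_trans g0 _; apply: divr_ge0 (ltW h); apply: mulr_ge0 => //; exact: dotv_ge0.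
have := dotv_CS (a - u) (v - th).
set X := dotv (a - u) (a - u) in au *; set Y := dotv (v - th) (v - th).
move=> cs; rewrite ler_pdivlMr// -(ler_pM2l g0).
have : g ^+ 2 <= X * Y.
  by apply: le_trans cs; rewrite ler_sqr ?nnegrE ?(ltW g0)// (le_trans (ltW g0) ge).
have Y0 : 0 <= Y := dotv_ge0 _.
move=> /(ler_wpM2r (ltW h)) => g2; have := ler_wpM2r Y0 au => g3.
rewrite mulrA -expr2; apply: le_trans g2 _.
by rewrite mulrAC (le_trans g3)// le_eqVlt; apply/orP; left; apply/eqP; ring.
Qed.

End Perturbation.

(** * Exact error of the least-squares estimates *)

Section Estimators.
Context {R : realType}.

Definition residue_count m n (k : 'I_m) : nat := \sum_(t < n | (k : nat) == (t %% m)%N) 1.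

(** The noise part of least squares: coordinate k averages the noise over the rounds that play
    direction k. *)
Definition residue_avg m n (e : nat -> R) : 'cV[R]_m :=
  \col_k ((residue_count n k)%:R^-1 * \sum_(t < n | (k : nat) == (t %% m)%N) e t).

Lemma mulmx1_invmx {n} (A B : 'M[R]_n) : A *m B = 1%:M -> invmx A = B.
Proof.
move=> AB; have [uA _] := mulmx1_unit AB.
by rewrite -[LHS]mulmx1 -AB mulmxA mulVmx// mul1mx.
Qed.

(** Cyclic play factors the design as a basis times this 0/1 matrix, whose Gram matrix is diagonal
    with the play counts; least squares then inverts explicitly. *)
Definition residue_mx m n : 'M[R]_(m, n) := \matrix_(k, j) ((k : nat) == (j %% m)%N)%:R.

Lemma explXE {d m} (A : 'M[R]_(d, m)) n : explX A n = A *m residue_mx m n.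
Proof.
apply/matrixP => i j; rewrite !mxE /cyc_col summxE big_mkcond /=.
by apply: eq_bigr => k _; rewrite !mxE; case: eqP; rewrite ?mulr1 ?mulr0.
Qed.

Lemma residue_mx_gram m n :
  residue_mx m n *m (residue_mx m n)^T = diag_mx (\row_k (residue_count n k)%:R).
Proof.
apply/matrixP => k l; rewrite !mxE.
have [->|kl] := eqVneq k l; rewrite ?mulr1n ?mulr0n.
  rewrite /residue_count natr_sum [RHS]big_mkcond; apply: eq_bigr => t _; rewrite !mxE.
  by case: eqP; rewrite ?mulr1 ?mulr0.
apply: big1 => t _; rewrite !mxE; case: eqP => [e1|]; rewrite ?mul0r//.
by case: eqP => [e2|]; rewrite ?mulr0//; move/eqP: kl; case; apply/val_inj; rewrite /= e1 -e2.
Qed.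

Lemma residue_avgE m n (e : nat -> R) :
  residue_avg m n e =
  diag_mx (\row_k (residue_count n k)%:R^-1) *m (residue_mx m n *m (\col_t e t)).
Proof.
apply/matrixP => k j; rewrite mul_diag_mx !mxE; congr (_ * _); rewrite [LHS]big_mkcond.
by apply: eq_bigr => t _; rewrite !mxE; case: eqP; rewrite ?mul1r ?mul0r.
Qed.

Lemma obsYE {d n} (X : 'M[R]_(d, n)) th e : obsY X th e = X^T *m th + \col_t e t.
Proof.
apply/matrixP => j i; rewrite !mxE; congr (_ + _); rewrite dotvE (ord1 i).
by apply: eq_bigr => k _; rewrite !mxE.
Qed.

Lemma diag_count_inv m n : (forall k : 'I_m, 0 < residue_count n k)%N ->
  diag_mx (\row_(k < m) (residue_count n k)%:R) *m diag_mx (\row_k (residue_count n k)%:R^-1)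
    = 1%:M :> 'M[R]_m.
Proof.
move=> c0; rewrite mulmx_diag; apply/matrixP => i j; rewrite !mxE divff//.
by rewrite pnatr_eq0 -lt0n.
Qed.

Lemma RE_est_error {d} N (A0 : 'M[R]_d) th e : A0^T *m A0 = 1%:M ->
  (forall k : 'I_d, 0 < residue_count (nexp R d N) k)%N ->
  RE_est N A0 th e = th + A0 *m residue_avg d (nexp R d N) e.
Proof.
move=> AA c0; rewrite /RE_est obsYE explXE; set n := nexp R d N in c0 *.
have AA' := mulmx1C AA; have dd := diag_count_inv c0.
rewrite residue_avgE; set Cm := residue_mx d n; set D := diag_mx _ in dd; set D' := diag_mx _ in dd *.
have CC : Cm *m Cm^T = D by exact: residue_mx_gram.
have -> : invmx (A0 *m Cm *m (A0 *m Cm)^T) = A0 *m D' *m A0^T.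
  apply: mulmx1_invmx; rewrite trmx_mul !mulmxA -(mulmxA A0) CC.
  by rewrite -(mulmxA (A0 *m D)) AA mulmx1 -(mulmxA A0) dd mulmx1.
rewrite mulmxDr !mulmxA; congr (_ + _).
  rewrite -(mulmxA _ A0^T) AA mulmx1 trmx_mul !mulmxA -(mulmxA _ Cm) CC.
  by rewrite -(mulmxA A0 D') (mulmx1C dd) mulmx1 AA' mul1mx.
by rewrite -(mulmxA _ A0^T) AA mulmx1.
Qed.

(** [Ab] and [Bh] are orthonormal bases of the same space, so Ab = Bh K^T with [K] orthogonal, and
    the change of basis cancels: what remains is the projection of [th] plus averaged noise carried
    by [Ab]. *)
Lemma RT_est_error {d r} N (Ab Bh : 'M[R]_(d, r)) th e :
  Bh^T *m Bh = 1%:M -> basis_spec Bh Ab ->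
  (forall k : 'I_r, 0 < residue_count (nexp R r N) k)%N ->
  RT_est N Ab Bh th e = Bh *m (Bh^T *m th) + Ab *m residue_avg r (nexp R r N) e.
Proof.
move=> BB [AA /andP[/submxP[K AK] _]] c0; rewrite /RT_est obsYE explXE.
set n := nexp R r N in c0 *; have dd := diag_count_inv c0.
rewrite residue_avgE; set Cm := residue_mx r n; set D := diag_mx _ in dd; set D' := diag_mx _ in dd *.
have CC : Cm *m Cm^T = D by exact: residue_mx_gram.
have AE : Ab = Bh *m K^T by rewrite -[Ab]trmxK AK trmx_mul trmxK.
have KK : K *m K^T = 1%:M by rewrite -AA AE trmx_mul trmxK mulmxA -(mulmxA K) BB mulmx1.
have KK' := mulmx1C KK.
have BA : Bh^T *m Ab = K^T by rewrite AE mulmxA BB mul1mx.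
have -> : invmx (Bh^T *m (Ab *m Cm) *m (Ab *m Cm)^T *m Bh) = K^T *m D' *m K.
  apply: mulmx1_invmx; rewrite trmx_mul !mulmxA BA -(mulmxA _ Ab^T).
  rewrite -[Bh in Ab^T *m Bh]trmxK -trmx_mul BA trmxK -(mulmxA K^T) CC.
  by rewrite -(mulmxA _ K) KK mulmx1 -(mulmxA K^T) dd mulmx1.
rewrite !mulmxDr !mulmxA; congr (_ + _).
  rewrite trmx_mul !mulmxA -(mulmxA _ Bh^T) BA -(mulmxA _ K) KK mulmx1 -(mulmxA _ Cm) CC.
  by rewrite -(mulmxA _ D') (mulmx1C dd) mulmx1 -AE AK mulmxA AE -(mulmxA Bh) KK' mulmx1.
by rewrite -(mulmxA _ Bh^T) BA -(mulmxA _ K) KK mulmx1 AE.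
Qed.

Lemma RT_est_error_sqr {d r} N (Ab Bh : 'M[R]_(d, r)) th e
    (x := th - Bh *m (Bh^T *m th)) (z := residue_avg r (nexp R r N) e) :
  Bh^T *m Bh = 1%:M -> basis_spec Bh Ab ->
  (forall k : 'I_r, 0 < residue_count (nexp R r N) k)%N ->
  dotv (RT_est N Ab Bh th e - th) (RT_est N Ab Bh th e - th) = dotv x x + dotv z z.
Proof.
move=> BB bs c0; rewrite RT_est_error//; have [AA /andP[/submxP[K AK] _]] := bs.
rewrite -/z (_ : _ - th = Ab *m z - x); last first.
  by rewrite /x opprB addrAC addrC.
have Bx : Bh^T *m x = 0 by rewrite /x mulmxBr (mulmxA Bh^T Bh) BB mul1mx subrr.
have Ax : dotv (Ab *m z) x = 0.
  by rewrite dotv_mull AK -mulmxA Bx mulmx0 dotv0r.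
clearbody x z.
rewrite !(dotvDl, dotvDr, dotvNl, dotvNr) (dotvC x) Ax (dotv_orth _ _ AA); ring.
Qed.

Lemma cyc_col_norm {d m} (A : 'M[R]_(d, m)) t : (0 < m)%N -> A^T *m A = 1%:M ->
  vnorm (cyc_col A t) <= 1.
Proof.
move=> m0 AA; pose k : 'I_m := Ordinal (ltn_pmod t m0).
have -> : cyc_col A t = A *m delta_mx k 0.
  rewrite /cyc_col (big_pred1 k) ?colE// => i.
by rewrite /vnorm dotv_orth// dotvE (bigD1 k)//= big1 ?mxE ?eqxx ?mulr1 ?addr0 ?sqrtr1// => i ik; rewrite !mxE (negbTE ik) mul0r.
Qed.

Lemma count_residues m n k : (k < m)%N ->
  (n %/ m <= \sum_(t < n | k == (t %% m)%N) 1)%N.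
Proof.
move=> km; have m0 : (0 < m)%N by exact: leq_ltn_trans km.
rewrite -(big_mkord (fun t => k == t %% m)%N (fun=> 1%N)).
elim/ltn_ind: n => n IH; have [nm|mn] := ltnP n m; first by rewrite divn_small.
have one : (\sum_(0 <= i < m | k == i %% m) 1 = 1)%N.
  rewrite big_mkord (big_pred1 (Ordinal km))// => i /=.
  by rewrite modn_small// eq_sym.
rewrite (big_cat_nat (n := m))//= one -[in X in (X %/ _)%N](subnK mn).
rewrite divnDr ?dvdnn// divnn m0 addnC leq_add2l.
rewrite [X in (_ <= X)%N](_ : _ = \sum_(0 + m <= i < n | k == i %% m) 1)%N; last by rewrite add0n.
rewrite big_addn; under eq_bigl do rewrite modnDr.
by apply: IH; rewrite ltn_subrL m0 (leq_trans m0 mn).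
Qed.

Lemma nexpE m N : (nexp R m N)%:R = (Num.ceil (m%:R * Num.sqrt (N%:R : R)))%:~R :> R.
Proof.
rewrite /nexp natr_absz ger0_norm// ceil_ge0 (lt_le_trans (ltrN10 _))//.
Qed.

Lemma nexp_ge m N : m%:R * Num.sqrt N%:R <= (nexp R m N)%:R :> R.
Proof. by rewrite nexpE ceil_ge. Qed.

Lemma nexp_le m N : (0 < m)%N -> (0 < N)%N ->
  (nexp R m N)%:R <= 2 * (m%:R * Num.sqrt N%:R) :> R.
Proof.
move=> m0 N0; have s1 : 1 <= Num.sqrt N%:R :> R by rewrite -{1}sqrtr1 ler_sqrt ?ler1n.
have m1 : 1 <= m%:R :> R by rewrite ler1n.
have x1 : 1 <= m%:R * Num.sqrt N%:R :> R.
  by apply: le_trans m1 _; rewrite ler_peMr// (le_trans ler01).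
rewrite nexpE; set x := _ * _ in x1 *.
by have /andP[] := ceil_itv x; rewrite intrD mulrN1z; lra.
Qed.

Lemma nexp_mono m m' N : (m <= m')%N -> (nexp R m N <= nexp R m' N)%N.
Proof.
move=> mm; rewrite -(ler_nat R) !nexpE ler_int; apply: le_ceil.
by rewrite ler_wpM2r ?sqrtr_ge0// ler_nat.
Qed.

(** Each direction is played at least q = n %/ m >= 1 times, and m sqrt N <= n <= (q + 1) m gives
    sqrt N <= q + 1 <= 2 q. *)
Lemma residue_count_ge m N (k : 'I_m) : (0 < N)%N ->
  Num.sqrt N%:R / 2 <= (residue_count (nexp R m N) k)%:R :> R.
Proof.
move=> N0; have m0 : (0 < m)%N by exact: leq_ltn_trans (ltn_ord k).
have s1 : 1 <= Num.sqrt N%:R :> R by rewrite -{1}sqrtr1 ler_sqrt ?ler1n.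
have mp : 0 < m%:R :> R by rewrite ltr0n.
set n := nexp R m N; have nge : m%:R * Num.sqrt N%:R <= n%:R :> R := nexp_ge m N.
apply: (@le_trans _ _ (n %/ m)%:R); last by rewrite ler_nat; exact: count_residues.
have q1 : 1 <= (n %/ m)%:R :> R.
  rewrite ler1n divn_gt0// -(ler_nat R) (le_trans _ nge)//.
  by rewrite -{1}[m%:R]mulr1 ler_wpM2l// ltW.
have : n%:R <= ((n %/ m)%:R + 1) * m%:R :> R.
  by rewrite natr1 -natrM ler_nat {1}(divn_eq n m) mulSn addnC leq_add2r ltnW// ltn_mod.
move=> /(le_trans nge); rewrite mulrC ler_pM2r//; lra.
Qed.

End Estimators.

(** * Combinatorics of the cycles *)

Section Schedule.

Definition cycle_start L n := (\sum_(1 <= m < n) (L + m * L))%N.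

Lemma cycle_startS L n : (0 < n)%N -> cycle_start L n.+1 = (cycle_start L n + (L + n * L))%N.
Proof. by move=> n0; rewrite /cycle_start big_nat_recr. Qed.

Lemma schedP L i : (0 < L)%N ->
  [/\ (0 < (sched L i).1)%N, ((sched L i).2 < L + (sched L i).1 * L)%N &
      i = (cycle_start L (sched L i).1 + (sched L i).2)%N].
Proof.
move=> L0; elim: i => [|i] /=; first by split; rewrite ?addn_gt0 ?L0// /cycle_start big_geq.
case: (sched L i) => n k /= [n0 kn iE]; case: (ltnP k.+1) => /= h; split => //.
- by rewrite iE addnS.
- by rewrite addn_gt0 L0.
- by rewrite cycle_startS// addn0 iE; lia.
Qed.

Lemma RE_sumS (V : nmodType) L i (f : nat -> V) :
  \sum_(0 <= j < i.+1 | is_RE L j) f j =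
  \sum_(0 <= j < i | is_RE L j) f j + (if is_RE L i then f i else 0).
Proof. by rewrite big_mkcond big_nat_recr//= -big_mkcond. Qed.

(** The eigenvalue hypothesis concerns windows of L consecutive tasks, so the RE tasks are regrouped
    into the blocks of earlier cycles and the part of the current block already played, which [minn]
    caps at L. *)
Lemma RE_sum (V : nmodType) L i (f : nat -> V) : (0 < L)%N ->
  \sum_(0 <= j < i | is_RE L j) f j =
  \sum_(1 <= m < (sched L i).1) \sum_(0 <= j < L) f (cycle_start L m + j)%N
  + \sum_(0 <= j < minn (sched L i).2 L) f (cycle_start L (sched L i).1 + j)%N.
Proof.
move=> L0; elim: i => [|i IH]; first by rewrite /= min0n !big_geq// addr0.
rewrite RE_sumS IH /is_RE /=; have := schedP i L0.
case: (sched L i) => n k /= [n0 kn iE].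
have [kL|Lk] := ltnP k L.
  have -> : (k.+1 < L + n * L)%N.
    by rewrite (leq_ltn_trans kL)// -addn1 leq_add2l muln_gt0 n0 L0.
  by rewrite /= (minn_idPl kL) big_nat_recr//= addrA -iE.
rewrite addr0; case: (ltnP k.+1) => /= h.
  by rewrite (minn_idPr (leqW Lk)).
by rewrite min0n [in RHS]big_nat_recr//= [X in _ = _ + X]big_geq// addr0.
Qed.

Lemma size_RE_tasks L i : (0 < L)%N -> ~~ is_RE L i ->
  size [seq j <- index_iota 0 i | is_RE L j] = ((sched L i).1 * L)%N.
Proof.
move=> L0; rewrite /is_RE -leqNgt => Lk.
rewrite -sum1_size big_filter.
have -> : (\sum_(0 <= j < i | is_RE L j) 1 =
    \sum_(1 <= m < (sched L i).1) \sum_(0 <= j < L) 1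
    + \sum_(0 <= j < minn (sched L i).2 L) 1)%N.
  exact: (RE_sum i (fun=> 1%N) L0).
rewrite (minn_idPr Lk) !sum_nat_const_nat !subn0 !muln1 -[X in (_ + X)%N]mul1n -mulnDl.
by have [n0 _ _] := schedP i L0; rewrite subn1 addn1 prednK.
Qed.

Lemma RE_blocks_before L i : (0 < L)%N -> ~~ is_RE L i ->
  (cycle_start L (sched L i).1 + L <= i)%N.
Proof.
move=> L0; rewrite /is_RE -leqNgt => Lk.
by have [_ _ {2}->] := schedP i L0; rewrite leq_add2l.
Qed.

Lemma cycle_start_homo L m n : (m <= n)%N -> (cycle_start L m <= cycle_start L n)%N.
Proof.
elim: n => [|n IH]; first by rewrite leqn0 => /eqP ->.
rewrite leq_eqVlt => /predU1P[->//|]; rewrite ltnS => /IH h; apply: leq_trans h _.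
case: n {IH} => [|n]; first by rewrite /cycle_start !big_geq.
by rewrite [leqRHS]cycle_startS// leq_addr.
Qed.

(** Inverted later: with [tau] tasks the square of the number of finished cycles is of order at most
    tau / L. *)
Lemma cycle_start_ge L n : (L * n ^ 2 <= 2 * cycle_start L n.+1)%N.
Proof.
elim: n => [|n IH]; first by rewrite exp0n// muln0.
rewrite cycle_startS//; move: IH; move: (cycle_start _ _) => c.
rewrite -!mulnn; nia.
Qed.

Context {R : realType}.

(** The share of the cost d sqrt N that is charged to a task. *)
Definition task_weight L i : R := if is_RE L i then 1 else (sched L i).1%:R^-1.

(** A full cycle weighs exactly 2 L: L for its RE tasks and n L times 1 / n for its RT tasks. The
    induction carries this as an equality, with a correction for the unfinished cycle. *)
Lemma task_weight_sum L i : (0 < L)%N ->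
  \sum_(0 <= j < i) task_weight L j <= 2 * (L%:R * (sched L i).1%:R).
Proof.
move=> L0.
(* [p n k] is the weight of the first k tasks of cycle n. *)
pose p (n k : nat) : R := if (k <= L)%N then k%:R else L%:R + (k%:R - L%:R) / n%:R.
suff [-> h] : \sum_(0 <= j < i) task_weight L j =
      2 * L%:R * ((sched L i).1%:R - 1) + p (sched L i).1 (sched L i).2 /\
    p (sched L i).1 (sched L i).2 <= 2 * L%:R by lra.
have b (n k : nat) : (0 < n)%N -> (k <= L + n * L)%N ->
    p n k <= 2 * L%:R.
  move=> n0 kn; rewrite /p; case: ifP => kL.
    by apply: (@le_trans _ _ L%:R); rewrite ?ler_nat// -[leLHS]mul1r ler_wpM2r// ler1n.
  have np : 0 < n%:R :> R by rewrite ltr0n.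
  have : (k%:R - L%:R) / n%:R <= L%:R :> R; last by lra.
  by rewrite ler_pdivrMr// lerBlDl mulrC -natrM -natrD ler_nat.
elim: i => [|i].
  rewrite big_geq//=; split; first by rewrite subrr mulr0 addr0.
  by rewrite mulr_ge0.
rewrite big_nat_recr//= /task_weight /is_RE.
have := schedP i L0; case: (sched L i) => n k /= [n0 kn iE] [-> _].
have np : n%:R != 0 :> R by rewrite pnatr_eq0 -lt0n.
have [kL|Lk] := ltnP k L.
  have kn' : (k.+1 < L + n * L)%N.
    by rewrite (leq_ltn_trans kL)// -addn1 leq_add2l muln_gt0 n0 L0.
  rewrite kn'; split; last by apply: b => //; exact: ltnW.
  by rewrite /p /= kL (ltnW kL) -natr1; ring.
have e : p n k + n%:R^-1 = L%:R + (k.+1%:R - L%:R) / n%:R.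
  rewrite /p; case: ifP => kL; last by rewrite -natr1; field.
  by have -> : k = L by [apply/eqP; rewrite eqn_leq kL Lk]; rewrite -natr1; field.
case: (ltnP k.+1) => h; split.
- by rewrite -addrA e /p ifN// -ltnNge.
- by apply: b => //; exact: ltnW.
- rewrite -addrA e /p /= addr0.
  have -> : k.+1 = (L + n * L)%N by apply/eqP; rewrite eqn_leq kn h.
  by rewrite -natr1 natrD natrM; field.
- by rewrite mulr_ge0.
Qed.

(** [topr] is called at the last RE position [L.-1], and the RT phase leaves the accumulated matrix
    unchanged, so every RT task sees singular vectors of the current matrix. The initial dummy 0
    never reaches an RT task, since each cycle opens with L > 0 RE tasks. *)
Lemma seq_stateP {d r} N L (A0 : 'M[R]_d) (topr : 'M[R]_d -> 'M[R]_(d, r))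
    (theta : nat -> 'cV[R]_d) (noise : nat -> nat -> R) i : (0 < L)%N ->
  let st := seq_state N L A0 topr theta noise in
  let th j := RE_est N A0 (theta j) (noise j) in
  (st i).1 = \sum_(0 <= j < i | is_RE L j) th j *m (th j)^T /\
  (~~ is_RE L i -> (st i).2 = topr (st i).1).
Proof.
move=> L0 st th; rewrite /st {st}.
elim: i => [|i [IH1 IH2]]; first by rewrite big_geq /is_RE /= ?L0.
rewrite RE_sumS -IH1 /=; move: IH1 IH2.
case: (seq_state _ _ _ _ _ _ i) => P Bh /= _ IH2; move: IH2; rewrite {2}/is_RE /is_RE /=.
have := schedP i L0; case: (sched L i) => n k /= [n0 kn _].
have [kL|Lk] := ltnP k L => IH2 /=.
  split => //; have kn' : (k.+1 < L + n * L)%N.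
    by rewrite (leq_ltn_trans kL)// -addn1 leq_add2l muln_gt0 n0 L0.
  rewrite kn' /= -leqNgt => Lk; rewrite ifT//.
  by rewrite -eqSS prednK// eqn_leq kL Lk.
split; first by rewrite addr0.
by case: ifP => h /=; rewrite ?L0// => _; exact: IH2.
Qed.

End Schedule.

(** * Moments of products of independent variables *)

Section IndependentMoments.
Context {dsp : measure_display} {T : measurableType dsp} {R : realType}.
Context (P : probability T R).
Local Open Scope classical_set_scope.
Import HBNNSimple.

(** Indicators, then simple functions, then monotone convergence. It serves to replace an indicator
    of [X] by [f (X)] inside a product bound. *)
Lemma le_integral_of_indic (X Z : T -> R) (C : \bar R) (f : R -> R) :
  measurable_fun setT X -> measurable_fun setT Z -> (forall w, 0 <= Z w) ->
  (0 <= C)%E ->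
  (forall B, measurable B ->
    (\int[P]_w (\1_B (X w) * Z w)%:E <= C * P (X @^-1` B))%E) ->
  measurable_fun setT f -> (forall x, 0 <= f x) ->
  (\int[P]_w (f (X w) * Z w)%:E <= C * \int[P]_w (f (X w))%:E)%E.
Proof.
move=> mX mZ Z0 C0 hB mf f0.
have mEf : measurable_fun [set: R] (fun x : R => (f x)%:E) by exact/measurable_EFinP.
have Ef0 (x : R) : setT x -> (0 <= (f x)%:E)%E by move=> _; rewrite lee_fin.
pose h := nnsfun_approx measurableT mEf.
have hf n x : h n x <= f x.
  by rewrite -lee_fin nnsfun_approxE; exact: le_approx.
have mhX n : measurable_fun setT (fun w => h n (X w)).
  by apply: (measurableT_comp _ mX); exact: measurable_funPT.
have step n : (\int[P]_w (h n (X w) * Z w)%:E <= C * \int[P]_w (h n (X w))%:E)%E.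
  pose s := finmap.enum_fset (fset_set (range (h n))).
  (* Absolute values do not change the values taken by the nonnegative [h n], and they make each
     term of the sum visibly nonnegative. *)
  have hE x : h n x = \sum_(y <- s) (`|y| * \1_(h n @^-1` [set y]) x).
    rewrite [LHS]fimfunE fsbig_finite//; apply: eq_bigr => y _.
    rewrite indicE; have [|] := boolP (x \in h n @^-1` [set y]); last by rewrite !mulr0.
    by move=> /set_mem <-; rewrite ger0_norm.
  have mB y : measurable (h n @^-1` [set y]) by exact: measurable_sfunP.
  have mI y : measurable_fun setT (fun w => \1_(h n @^-1` [set y]) (X w) : R).
    by apply: (measurableT_comp _ mX); exact: measurable_indic.
  under eq_integral do rewrite hE mulr_suml -sumEFin.
  rewrite ge0_integral_sum//; last 2 first.
  - move=> y; apply/measurable_EFinP; apply: measurable_funM => //.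
    exact: measurable_funM.
  - by move=> y w _; rewrite lee_fin !mulr_ge0.
  under [X in (_ <= _ * X)%E]eq_integral do rewrite hE -sumEFin.
  rewrite [X in (_ <= _ * X)%E]ge0_integral_sum//; last first.
    by move=> y; apply/measurable_EFinP; exact: measurable_funM.
  rewrite ge0_sume_distrr; last first.
    by move=> y _; apply: integral_ge0 => w _; rewrite lee_fin mulr_ge0.
  apply: lee_sum => y _.
  under eq_integral do rewrite -mulrA EFinM.
  rewrite ge0_integralZl_EFin//; last 2 first.
  - by move=> w _; rewrite lee_fin mulr_ge0.
  - by apply/measurable_EFinP; exact: measurable_funM.
  under [X in (_ <= _ * X)%E]eq_integral do rewrite EFinM.
  rewrite [X in (_ <= _ * X)%E]ge0_integralZl_EFin//; last by apply/measurable_EFinP.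
  rewrite muleCA lee_wpmul2l ?lee_fin//.
  apply: le_trans (hB _ (mB y)) _; rewrite lee_wpmul2l//.
  rewrite -[X @^-1` _]setIT -integral_indic//; last first.
    by rewrite -[X @^-1` _]setTI; exact: mX.
have gZ : (\int[P]_w (h n (X w) * Z w)%:E @[n --> \oo] -->
    \int[P]_w (limn (fun n => (h n (X w) * Z w)%:E)))%E.
  apply: cvg_monotone_convergence => //.
  - by move=> n; apply/measurable_EFinP; exact: measurable_funM.
  - by move=> n w _; rewrite lee_fin mulr_ge0.
  - move=> w _ n m nm; rewrite lee_fin ler_wpM2r//.
    by have /lefP := nd_nnsfun_approx measurableT mEf nm; apply.
have limE w : limn (fun n => (h n (X w) * Z w)%:E) = (f (X w) * Z w)%:E.
  apply/cvg_lim => //; rewrite EFinM.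
  under eq_fun do rewrite EFinM.
  by apply: cvgeZr => //; exact: (cvg_nnsfun_approx measurableT mEf Ef0).
under eq_integral do rewrite -limE.
rewrite -(cvg_lim _ gZ)//; apply: lime_le; first by apply/cvg_ex; eexists; exact: gZ.
near=> n; apply: le_trans (step n) _; rewrite lee_wpmul2l//.
apply: ge0_le_integral => //.
- by move=> w _; rewrite lee_fin.
- exact/measurable_EFinP.
- by apply/measurable_EFinP; exact: (measurableT_comp mf mX).
- by move=> w _; rewrite lee_fin.
Unshelve. all: by end_near. Qed.

Lemma measurable_comp_indic (X : T -> R) (B : set R) :
  measurable_fun setT X -> measurable B -> measurable_fun setT (fun w => \1_B (X w) : R).
Proof. by move=> mX mB; apply: (measurableT_comp _ mX); exact: measurable_indic. Qed.

(** Independence is given on events, so the induction starts from indicators alone and turns them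
    into [f j] one at a time. The list [s2] holds the indices still at the indicator stage: the step
    moves the head of [s1] there, applies the induction hypothesis with an arbitrary event at that
    index, and passes from events to [f j]. *)
Lemma indep_prod_le (I : eqType) (D : set I) (X : I -> T -> R) (f : I -> R -> R)
    (K : I -> R) (s1 s2 : seq I) (A : I -> set R) :
  mutual_indep P D X ->
  (forall j, D j -> measurable_fun setT (X j)) ->
  (forall j, measurable_fun setT (f j)) -> (forall j x, 0 <= f j x) ->
  (forall j, D j -> \int[P]_w (f j (X j w))%:E <= (K j)%:E)%E ->
  (forall j, measurable (A j)) -> uniq (s1 ++ s2) -> (forall j, j \in s1 ++ s2 -> D j) ->
  (\int[P]_w ((\prod_(j <- s1) f j (X j w)) * \prod_(j <- s2) \1_(A j) (X j w))%:E
    <= (\prod_(j <- s1) K j)%:E * \prod_(j <- s2) P (X j @^-1` A j))%E.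
Proof.
move=> ind mX mf f0 fK.
have K0 j : D j -> 0 <= K j.
  move=> Dj; rewrite -lee_fin; apply: le_trans (fK j Dj).
  by apply: integral_ge0 => w _; rewrite lee_fin.
elim: s1 s2 A => [|j s1 IH] s2 A mA us Ds.
  rewrite big_nil mul1e -ind//.
  under eq_integral.
    move=> w _; rewrite big_nil mul1r.
    have -> : \prod_(j <- s2) \1_(A j) (X j w) =
        \1_(\big[setI/setT]_(j <- s2) (X j @^-1` A j)) w :> R.
      elim: s2 {us Ds} => [|i s IHs]; first by rewrite !big_nil indicT.
      by rewrite !big_cons indicI /= IHs.
    over.
  rewrite integral_indic ?setIT//.
  move: Ds; rewrite /= => Ds; rewrite big_seq.
  apply: (big_ind (fun S => measurable S)) => //; first exact: measurableI.
  by move=> i si; rewrite -[_ @^-1` _]setTI; apply: mX => //; exact: Ds.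
have Dj : D j by apply: Ds; rewrite mem_head.
have mZ : measurable_fun setT (fun w => (\prod_(i <- s1) f i (X i w)) *
    \prod_(i <- s2) \1_(A i) (X i w) : R).
  apply: measurable_funM; apply: measurable_prod => i si.
    apply: (measurableT_comp (mf i)); apply: mX; apply: Ds.
    by rewrite inE mem_cat si orbT.
  apply: measurable_comp_indic => //; apply: mX; apply: Ds.
  by rewrite inE mem_cat si !orbT.
under eq_integral do rewrite big_cons -mulrA.
set C := ((\prod_(i <- s1) K i)%:E * \prod_(i <- s2) P (X i @^-1` A i))%E.
have C0 : (0 <= C)%E.
  apply: mule_ge0; last by apply: prode_ge0 => i _.
  rewrite lee_fin big_seq; apply: prodr_ge0 => i si; apply: K0; apply: Ds.
  by rewrite inE mem_cat si orbT.
have hB B : measurable B -> (\int[P]_w (\1_B (X j w) * ((\prod_(i <- s1) f i (X i w)) *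
    \prod_(i <- s2) \1_(A i) (X i w)))%:E <= C * P (X j @^-1` B))%E.
  (* Putting [B] at j leaves the other events alone, since uniqueness keeps j out of [s2]. *)
  move=> mB; pose A' i := if i == j then B else A i.
  have A'j : A' j = B by rewrite /A' eqxx.
  have js2 : j \notin s2 by move: us; rewrite /= mem_cat negb_or => /andP[/andP[]].
  have A's2 i : i \in s2 -> A' i = A i.
    by move=> si; rewrite /A' ifN//; apply: contraNneq js2 => <-.
  have perm : perm_eq ((j :: s1) ++ s2) (s1 ++ j :: s2) by rewrite perm_sym perm_catC /= perm_cons perm_catC.
  have mA' i : measurable (A' i) by rewrite /A'; case: ifP.
  have us' : uniq (s1 ++ j :: s2) by rewrite -(perm_uniq perm).
  have Ds' i : i \in s1 ++ j :: s2 -> D i by rewrite -(perm_mem perm); exact: Ds.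
  have := IH (j :: s2) A' mA' us' Ds'; rewrite big_cons A'j.
  rewrite (eq_big_seq (fun i => P (X i @^-1` A i))) => [|i si]; last by rewrite A's2.
  rewrite muleCA (muleC (P _)) -/C; apply: le_trans; rewrite le_eqVlt; apply/orP; left.
  apply/eqP; apply: eq_integral => w _; rewrite big_cons A'j mulrCA; congr (_ * (_ * _))%:E.
  by apply: eq_big_seq => i si; rewrite A's2.
apply: le_trans (le_integral_of_indic (mX j Dj) mZ _ C0 hB (mf j) (f0 j)) _.
  move=> w; apply: mulr_ge0; first by apply: prodr_ge0 => i _.
  by apply: prodr_ge0 => i _.
apply: (@le_trans _ _ (C * (K j)%:E)%E); first by rewrite lee_wpmul2l// fK.
by rewrite /C big_cons EFinM muleC muleA.
Qed.

End IndependentMoments.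

(** * Measurable majorants and sub-Gaussian maxima *)

Section UpperExpectation.
Context {dsp : measure_display} {T : measurableType dsp} {R : realType}.
Context (P : probability T R).

(* The projections returned by the algorithm need not depend measurably on the
   noise, so expectations are bounded through measurable majorants. *)
Definition uexp (f : T -> R) (c : R) : Prop :=
  exists g : T -> R, [/\ measurable_fun setT g, forall w, 0 <= g w,
    forall w, f w <= g w & (\int[P]_w (g w)%:E <= c%:E)%E].

(** This covers non-measurable [f]: the integral of the positive part is a supremum over simple
    functions below it, which also lie below [g], and the negative part only lowers the value. *)
Lemma uexp_integral f c : uexp f c -> (\int[P]_w (f w)%:E <= c%:E)%E.
Proof.
move=> [g [mg g0 fg gc]]; apply: le_trans gc.
rewrite integralE -[leRHS]adde0; apply: leeD; last first.
  by rewrite oppe_le0 integral_ge0.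
rewrite ge0_integralTE//.
rewrite ge0_integralTE => [|w]; last by rewrite lee_fin.
apply: ereal_sup_le => _ [h hf <-]; exists h => //= w; apply: le_trans (hf w) _.
by rewrite funeposE ge_max !lee_fin fg g0.
Qed.

Lemma uexp_self (g : T -> R) c : measurable_fun setT g -> (forall w, 0 <= g w) ->
  (\int[P]_w (g w)%:E <= c%:E)%E -> uexp g c.
Proof. by move=> mg g0 gc; exists g; split. Qed.

Lemma uexp_le f f' c c' : (forall w, f w <= f' w) -> c' <= c -> uexp f' c' -> uexp f c.
Proof.
move=> ff cc [g [mg g0 fg gc]]; exists g; split => // [w|].
  exact: le_trans (ff w) (fg w).
by apply: le_trans gc _; rewrite lee_fin.
Qed.

Lemma uexp_cst a : 0 <= a -> uexp (fun=> a) a.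
Proof.
move=> a0; apply: uexp_self => //.
by rewrite integral_cst// [X in (_ * X)%E]probability_setT mule1.
Qed.

Lemma uexpD f1 f2 c1 c2 : uexp f1 c1 -> uexp f2 c2 -> uexp (f1 \+ f2) (c1 + c2).
Proof.
move=> [g1 [m1 p1 l1 b1]] [g2 [m2 p2 l2 b2]]; exists (g1 \+ g2); split => /=.
- exact: measurable_funD.
- by move=> w; rewrite addr_ge0.
- by move=> w; rewrite lerD.
- under eq_integral do rewrite EFinD.
  rewrite ge0_integralD//; first by rewrite EFinD leeD.
  + by move=> w _; rewrite lee_fin.
  + exact/measurable_EFinP.
  + by move=> w _; rewrite lee_fin.
  + exact/measurable_EFinP.
Qed.

Lemma uexpZ a f c : 0 <= a -> uexp f c -> uexp (fun w => a * f w) (a * c).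
Proof.
move=> a0 [g [mg g0 fg gc]]; exists (fun w => a * g w); split => //.
- exact: measurable_funM.
- by move=> w; rewrite mulr_ge0.
- by move=> w; rewrite ler_wpM2l.
- under eq_integral do rewrite EFinM.
  rewrite ge0_integralZl_EFin//; last 2 first.
  + by move=> w _; rewrite lee_fin.
  + exact/measurable_EFinP.
  by rewrite EFinM lee_wpmul2l ?lee_fin.
Qed.

Lemma uexp_sum (I : eqType) (s : seq I) (Q : pred I) (f : I -> T -> R) (c : I -> R) :
  (forall i, i \in s -> Q i -> uexp (f i) (c i)) ->
  uexp (fun w => \sum_(i <- s | Q i) f i w) (\sum_(i <- s | Q i) c i).
Proof.
elim: s => [|i s IH] h.
  apply: (@uexp_le _ (fun=> 0) _ 0); rewrite ?big_nil//; last exact: uexp_cst.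
  by move=> w; rewrite big_nil.
have IHs : uexp (fun w => \sum_(i <- s | Q i) f i w) (\sum_(i <- s | Q i) c i).
  by apply: IH => j js; apply: h; rewrite inE js orbT.
have [Qi|Qi] := boolP (Q i); last first.
  by apply: uexp_le IHs; rewrite ?big_cons ?(negbTE Qi)// => w; rewrite big_cons (negbTE Qi).
apply: uexp_le (uexpD (h i (mem_head _ _) Qi) IHs); rewrite ?big_cons ?Qi// => w.
by rewrite big_cons Qi.
Qed.

Definition subgaussian (v : R) (X : T -> R) : Prop :=
  measurable_fun setT X /\
  forall lam, (\int[P]_w (expR (lam * X w))%:E <= (expR (lam ^+ 2 * v / 2))%:E)%E.

Lemma subgaussian_uexp v X lam : subgaussian v X ->
  uexp (fun w => expR (lam * X w)) (expR (lam ^+ 2 * v / 2)).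
Proof.
move=> [mX h]; apply: uexp_self => [|w|]; last exact: h.
- by apply: (measurableT_comp (@measurable_expR R)); exact: measurable_funM.
- exact: expR_ge0.
Qed.

Lemma sqr_le_expR (x : R) : 0 <= x -> x ^+ 2 <= 4 * expR x.
Proof.
move=> x0; have -> : x = x / 2 + x / 2 by field.
rewrite expRD; have := expR_ge1Dx (x / 2); set e := expR _ => h.
have : (1 + x / 2) ^+ 2 <= e * e.
  by rewrite expr2; apply: ler_pM => //; lra.
nra.
Qed.

(* Union bound: with [lam^2 = l / v] and threshold [A = 2 l / lam], the
   exponential moments of the at most [e^l] variables contribute at most 1. *)
Lemma subgaussian_max (F : finType) (S : pred F) (X : F -> T -> R) v l :
  0 < v -> 1 <= l -> #|S|%:R <= expR l ->
  (forall f, f \in S -> subgaussian v (X f)) ->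
  exists g : T -> R, uexp g (16 * l * v) /\ forall w, 0 <= g w /\
    forall y, (exists2 f, f \in S & y <= X f w) -> 0 <= y -> y ^+ 2 <= g w.
Proof.
move=> v0 l1 Sl sX; have l0 : 0 < l by exact: lt_le_trans l1.
pose lam := Num.sqrt (l / v); have lam0 : 0 < lam by rewrite sqrtr_gt0 divr_gt0.
have lamE : lam ^+ 2 = l / v by rewrite sqr_sqrtr// divr_ge0 ?ltW.
pose A := 2 * l / lam; have A0 : 0 <= A by rewrite divr_ge0 ?mulr_ge0 ?ltW.
have AE : A ^+ 2 = 4 * l * v.
  by rewrite /A expr_div_n lamE; field; rewrite !gt_eqF.
(* Beyond the threshold, y^2 <= 2 A^2 + 2 (y - A)^2, and [sqr_le_expR] at lam (y - A) gives 2 (y -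
   A)^2 <= (8 / lam^2) exp (lam y - lam A) with lam A = 2 l. *)
pose B := 8 / lam ^+ 2 * expR (- (2 * l)).
have B0 : 0 <= B by rewrite mulr_ge0 ?expR_ge0// divr_ge0 ?sqr_ge0.
exists (fun w => 2 * A ^+ 2 + B * \sum_(f <- enum F | f \in S) expR (lam * X f w)); split.
  have h1 : uexp (fun w => \sum_(f <- enum F | f \in S) expR (lam * X f w))
      (\sum_(f <- enum F | f \in S) expR (lam ^+ 2 * v / 2)).
    by apply: uexp_sum => f _ /sX; exact: subgaussian_uexp.
  have A2 : 0 <= 2 * A ^+ 2 by rewrite mulr_ge0// sqr_ge0.
  apply: uexp_le (uexpD (uexp_cst A2) (uexpZ B0 h1)) => //.
  rewrite AE.
  rewrite (_ : \sum_(i <- enum F | i \in S) _ = expR (l / 2) * #|S|%:R); last first.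
    rewrite big_enum_cond sumr_const -[LHS]mulr_natr; congr (expR _ * _).
    by rewrite lamE; field; rewrite gt_eqF.
  (* The exponents add up to - 2 l + l / 2 + l <= 0, which leaves 8 / lam^2 = 8 v / l <= 8 v; with 2
     A^2 = 8 l v the total is at most 16 l v. *)
  have h : B * (expR (l / 2) * #|S|%:R) <= 8 * v.
    apply: (@le_trans _ _ (B * (expR (l / 2) * expR l))).
      by apply: ler_wpM2l => //; apply: ler_wpM2l => //; exact: expR_ge0.
    rewrite /B -expRD -mulrA -expRD lamE.
    apply: (@le_trans _ _ (8 / (l / v) * 1)).
      apply: ler_wpM2l; first by rewrite !divr_ge0 ?ltW.
      by rewrite -[leRHS]expR0 ler_expR; lra.
    rewrite mulr1 invf_div mulrA ler_pdivrMr// ler_peMr// mulr_ge0// ltW//.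
  have : v <= l * v by rewrite ler_peMl// ltW.
  lra.
move=> w; set Sg := \sum_(f <- _ | _) _.
have Sg0 : 0 <= Sg by apply: sumr_ge0 => f _; exact: expR_ge0.
have BS : 0 <= B * Sg by rewrite mulr_ge0.
split; first by rewrite addr_ge0// mulr_ge0// sqr_ge0.
move=> y [f fS yX] y0; have [yA|Ay] := leP y A.
  have : y ^+ 2 <= A ^+ 2 by rewrite ler_sqr ?nnegrE.
  have := sqr_ge0 A; lra.
suff : (y - A) ^+ 2 * 2 <= B * Sg by have := sqr_ge0 (y - 2 * A); lra.
have fs : expR (lam * X f w) <= Sg.
  rewrite /Sg big_enum_cond (bigD1 f)//= lerDl.
  by apply: sumr_ge0 => i _; exact: expR_ge0.
apply: (@le_trans _ _ (B * expR (lam * X f w))); last by rewrite ler_wpM2l.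
have : (lam * (y - A)) ^+ 2 <= 4 * expR (lam * (y - A)).
  by apply: sqr_le_expR; apply: mulr_ge0; rewrite ?subr_ge0 ltW.
have -> : expR (lam * (y - A)) = expR (- (2 * l)) * expR (lam * y).
  by rewrite -expRD; congr expR; rewrite /A; field; rewrite gt_eqF.
have : expR (lam * y) <= expR (lam * X f w) by rewrite ler_expR ler_pM2l.
set e1 := expR (lam * y); set e2 := expR (lam * X f w); move=> e12.
rewrite exprMn => h.
have l20 : 0 < lam ^+ 2 by rewrite exprn_gt0.
have -> : B * e2 = 8 * (expR (- (2 * l)) * e2) / lam ^+ 2.
  by rewrite /B -!mulrA; congr (_ * _); rewrite mulrC mulrA.
rewrite ler_pdivlMr//.
have : expR (- (2 * l)) * e1 <= expR (- (2 * l)) * e2 by rewrite ler_wpM2l// expR_ge0.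
by set z1 := _ * e1 in h *; set z2 := _ * e2; lra.
Qed.

Lemma subgaussian_opp v X : subgaussian v X -> subgaussian v (fun w => - X w).
Proof.
move=> [mX h]; split; first exact: measurable_funN.
by move=> lam; under eq_integral do rewrite mulrN -mulNr; rewrite -(sqrrN lam); exact: h.
Qed.

(** The square is controlled by the maximum of the pair [X], [- X]; l = 1 is allowed because 2 <=
    e. *)
Lemma subgaussian_sqr v X : 0 < v -> subgaussian v X ->
  uexp (fun w => X w ^+ 2) (16 * v).
Proof.
move=> v0 sX.
have [||b _|g [ug hg]] := @subgaussian_max bool predT
    (fun b w => if b then X w else - X w) v 1 v0.
- by [].
- rewrite card_bool; have := expR_ge1Dx (1 : R); lra.
- by case: b; [exact: sX|exact: subgaussian_opp].
apply: uexp_le ug; last by rewrite mulr1.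
move=> w; have [_ h] := hg w; rewrite -[_ ^+ 2]real_normK ?num_real//; apply: h => //.
have [x0|x0] := leP 0 (X w); first by exists true => //; rewrite ger0_norm.
by exists false => //; rewrite ltr0_norm.
Qed.

(** Exponential moments multiply over the independent pairs (task, round), so the variance proxies
    c^2 add up. *)
Lemma noise_subgaussian tau N (eta : nat -> nat -> T -> R) (I : seq nat) n
    (c : nat -> nat -> R) v :
  noise_model P tau N eta -> uniq I -> (forall i, i \in I -> (i < tau)%N) -> (n <= N)%N ->
  \sum_(i <- I) \sum_(0 <= t < n) c i t ^+ 2 <= v ->
  subgaussian v (fun w => \sum_(i <- I) \sum_(0 <= t < n) c i t * eta i t w).
Proof.
move=> [ne ind] uI It nN cv.
pose s := [seq (i, t) | i <- I, t <- index_iota 0 n].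
have sD j : j \in s -> (j.1 < tau)%N /\ (j.2 < N)%N.
  move=> /allpairsP[[i t] /= [iI tn ->]]; split; first exact: It.
  by move: tn; rewrite mem_index_iota /= => /leq_trans; apply.
have us : uniq s.
  by apply: allpairs_uniq => //; [exact: iota_uniq|move=> [? ?] [? ?] _ _ /= [-> ->]].
have sumE (f : nat -> nat -> R) :
    \sum_(i <- I) \sum_(0 <= t < n) f i t = \sum_(j <- s) f j.1 j.2.
  by rewrite big_allpairs_dep /=.
have mE j : j \in s -> measurable_fun setT (eta j.1 j.2).
  by move=> /sD[h1 h2]; have [] := ne _ _ h1 h2.
split.
  (* Cut off outside [s], the summand is measurable at every index, as [measurable_sum] demands. *)
  pose F (j : nat * nat) (w : T) := if j \in s then c j.1 j.2 * eta j.1 j.2 w else 0.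
  rewrite (_ : (fun w => _) = (fun w => \sum_(j <- s) F j w)).
    apply: measurable_sum => j; rewrite /F; case js: (j \in s) => //.
    by apply: measurable_funM => //; exact: mE.
  apply/funext => w; rewrite (sumE (fun i t => c i t * eta i t w)).
  by apply: eq_big_seq => j js; rewrite /F js.
move=> lam.
have expR_sum (J : Type) (r : seq J) (f : J -> R) :
    expR (\sum_(j <- r) f j) = \prod_(j <- r) expR (f j).
  by apply: (big_morph expR (@expRD R) (@expR0 R)).
have := @indep_prod_le _ _ _ P _ _ (fun ij : nat * nat => eta ij.1 ij.2)
  (fun ij x => expR (lam * c ij.1 ij.2 * x)) (fun ij => expR ((lam * c ij.1 ij.2) ^+ 2 / 2))
  s [::] (fun=> setT) ind.
under eq_integral do rewrite big_nil mulr1.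
rewrite big_nil mule1 cats0 => h.
under eq_integral do rewrite sumE mulr_sumr expR_sum.
under eq_integral do under eq_bigr do rewrite mulrA.
apply: le_trans (h _ _ _ _ _ us sD) _ => //.
- by move=> j [h1 h2]; have [] := ne _ _ h1 h2.
- by move=> j; apply: (measurableT_comp (@measurable_expR R)); exact: measurable_funM.
- by move=> j [h1 h2]; have [_ [_]] := ne _ _ h1 h2; apply.
rewrite lee_fin -expR_sum ler_expR.
rewrite (eq_bigr (fun j => lam ^+ 2 / 2 * c j.1 j.2 ^+ 2)); last by move=> j _; field.
rewrite -mulr_sumr -(sumE (fun i t => c i t ^+ 2)) [leRHS]mulrAC.
by rewrite ler_wpM2l// divr_ge0// sqr_ge0.
Qed.

End UpperExpectation.

(** * Operator norm of the averaged noise *)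

Section NoiseOperatorNorm.
Context {R : realType}.

Lemma grid_below (D : nat) (u : R) : (0 < D)%N -> `|u| <= 1 ->
  exists j : nat, (j <= 2 * D)%N /\
    let g := (j%:R - D%:R) / D%:R in g <= u /\ u - g <= D%:R^-1.
Proof.
move=> D0; rewrite ler_norml => /andP[u1 u2]; have Dp : 0 < D%:R :> R by rewrite ltr0n.
pose x := D%:R * (u + 1); have x0 : 0 <= x by apply: mulr_ge0; [exact: ltW|lra].
have /andP[tx xt] := truncn_itv x0; exists (Num.truncn x); split.
  rewrite -(ler_nat R); apply: le_trans tx _.
  by rewrite /x natrM mulrC; apply: ler_wpM2r; [exact: ltW|lra].
rewrite /=; move: tx xt; rewrite -natr1; set t := (Num.truncn _)%:R; rewrite /x => tx xt.
split; first by rewrite ler_pdivrMr//; lra.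
have -> : u - (t - D%:R) / D%:R = (u * D%:R - t + D%:R) / D%:R by field; rewrite gt_eqF.
by rewrite -[leRHS]mul1r ler_pM2r ?invr_gt0//; lra.
Qed.

(* Rounding each coordinate in the direction of the sign of [a k] does not
   decrease the linear functional [a], so the net loses no constant factor. *)
Lemma grid_round (D : nat) (u a : R) : (0 < D)%N -> `|u| <= 1 ->
  exists j : 'I_(2 * D).+1,
    let g := (j%:R - D%:R) / D%:R in `|g - u| <= D%:R^-1 /\ u * a <= g * a.
Proof.
move=> D0 u1; have Dp : 0 < D%:R :> R by rewrite ltr0n.
have Di : 0 <= D%:R^-1 :> R by rewrite invr_ge0 ltW.
have [a0|a0] := leP 0 a.
  have [|j [jD /= [h1 h2]]] := @grid_below D (- u) D0; first by rewrite normrN.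
  have jD' : (2 * D - j < (2 * D).+1)%N by rewrite ltnS leq_subr.
  exists (Ordinal jD') => /=.
  have -> : ((2 * D - j)%:R - D%:R) / D%:R = - ((j%:R - D%:R) / D%:R) :> R.
    by rewrite natrB// natrM; field; rewrite gt_eqF.
  by split; [rewrite ler_norml; apply/andP; split; lra|rewrite ler_wpM2r//; lra].
have [j [jD /= [h1 h2]]] := @grid_below D u D0 u1.
exists (Ordinal (jD : j < (2 * D).+1)%N) => /=; split.
  by rewrite ler_norml; apply/andP; split; lra.
by rewrite ler_wnM2r// ltW.
Qed.

(** The resolution equals the dimension: rounding a unit vector moves it by at most d / d^2 <= 1 in
    squared norm, so the net vectors needed have squared norm at most 4. The grid has (2 d + 1)^d
    points, and this is where the logarithm enters. *)
Definition grid_vec d (f : {ffun 'I_d -> 'I_(2 * d).+1}) : 'cV[R]_d :=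
  \col_k (((f k)%:R - d%:R) / d%:R).

Lemma grid_vec_round d (u a : 'cV[R]_d) : (0 < d)%N -> dotv u u <= 1 ->
  exists f : {ffun 'I_d -> 'I_(2 * d).+1},
    dotv (grid_vec f) (grid_vec f) <= 4 /\ dotv u a <= dotv (grid_vec f) a.
Proof.
move=> d0 u1; have dp : 0 < d%:R :> R by rewrite ltr0n.
have uk k : `|u k 0| <= 1.
  rewrite -(ler_pXn2r (n := 2))// ?nnegrE// expr1n real_normK ?num_real//.
  apply: le_trans u1; rewrite dotvE (bigD1 k)//= expr2 lerDl.
  by apply: sumr_ge0 => i _; rewrite -expr2 sqr_ge0.
have /fin_all_exists[f fP] := fun k => grid_round (a k 0) d0 (uk k).
exists [ffun k => f k]; split; last first.
  by rewrite !dotvE; apply: ler_sum => k _; rewrite mxE ffunE; have [] := fP k.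
apply: (@le_trans _ _ (\sum_k (2 * u k 0 ^+ 2 + 2 * (d%:R^-1) ^+ 2))).
  rewrite dotvE; apply: ler_sum => k _; rewrite mxE ffunE; have [h _] := fP k.
  set g := _ / _ in h *.
  have : (g - u k 0) ^+ 2 <= d%:R^-1 ^+ 2.
    by rewrite -[leLHS]real_normK ?num_real// ler_pXn2r// nnegrE// invr_ge0 ltW.
  have := sqr_ge0 (g - 2 * u k 0); lra.
rewrite big_split /= -mulr_sumr sumr_const card_ord -[_ *+ d]mulr_natr.
have -> : \sum_i u i 0 ^+ 2 = dotv u u by rewrite dotvE; apply: eq_bigr => k _; rewrite expr2.
have : 2 * d%:R^-1 ^+ 2 * d%:R <= 2 :> R.
  rewrite expr2 -!mulrA mulVf ?gt_eqF// mulr1 ler_piMr// invf_le1// ler1n//.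
lra.
Qed.

Lemma residue_avg_dot m n (e : nat -> R) (u : 'cV[R]_m) :
  dotv (residue_avg m n e) u =
  \sum_(0 <= t < n) (\sum_(k < m | (k : nat) == (t %% m)%N) (residue_count n k)%:R^-1 * u k 0) * e t.
Proof.
rewrite dotvE big_mkord.
under [RHS]eq_bigr do rewrite big_distrl big_mkcond /=.
rewrite exchange_big /=; apply: eq_bigr => k _.
rewrite mxE mulr_sumr mulr_suml big_mkcond /=; apply: eq_bigr => t _.
by case: ifP => // _; rewrite mulrAC.
Qed.

(** A round plays one direction, so the inner sum has a single term. Direction k, played c >= sqrt N
    / 2 times, contributes c (u_k / c)^2 = u_k^2 / c. *)
Lemma residue_avg_variance m N (u : 'cV[R]_m) (n := nexp R m N) : (0 < N)%N ->
  \sum_(0 <= t < n) (\sum_(k < m | (k : nat) == (t %% m)%N) (residue_count n k)%:R^-1 * u k 0) ^+ 2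
   <= 2 / Num.sqrt N%:R * dotv u u.
Proof.
move=> N0; have sN : 0 < Num.sqrt N%:R :> R by rewrite sqrtr_gt0 ltr0n.
have [m0|m0] := posnP m.
  rewrite big1; first by rewrite mulr_ge0 ?dotv_ge0// divr_ge0// ltW.
  move=> t _; rewrite big1 ?expr0n// => k; by have := ltn_ord k; rewrite {2}m0.
have -> : \sum_(0 <= t < n) (\sum_(k < m | (k : nat) == (t %% m)%N) (residue_count n k)%:R^-1 * u k 0) ^+ 2
    = \sum_(0 <= t < n) \sum_(k < m | (k : nat) == (t %% m)%N) ((residue_count n k)%:R^-1 * u k 0) ^+ 2.
  apply: eq_bigr => t _; have h (k : 'I_m) : ((k : nat) == (t %% m)%N) = (k == Ordinal (ltn_pmod t m0)) by [].
  by rewrite !(big_pred1 _ h).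
rewrite big_mkord; under eq_bigr do rewrite big_mkcond /=.
rewrite exchange_big /= dotvE mulr_sumr; apply: ler_sum => k _.
rewrite -big_mkcond /= sumr_const -[leLHS]mulr_natl exprMn mulrA -expr2.
have c0 := residue_count_ge (R := R) k N0; rewrite -/n in c0.
have cE : #|[pred t : 'I_n | (k : nat) == (t %% m)%N]| = residue_count n k.
  by rewrite /residue_count sum1_card.
rewrite cE; set c := (residue_count n k)%:R in c0 *.
have cp : 0 < c by rewrite (lt_le_trans _ c0)// divr_gt0.
rewrite ler_wpM2r ?sqr_ge0//.
have -> : c * c^-1 ^+ 2 = c^-1 by field; rewrite gt_eqF.
have -> : 2 / Num.sqrt N%:R = (Num.sqrt N%:R / 2)^-1 :> R by rewrite invf_div.
by rewrite lef_pV2// posrE divr_gt0.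
Qed.

Context {dsp : measure_display} {T : measurableType dsp}.
Context (P : probability T R) (tau N : nat) (eta : nat -> nat -> T -> R).
Context (noise : noise_model P tau N eta) (N0 : (0 < N)%N).

Lemma avg_subgaussian m (I : seq nat) (c : nat -> R) (u : 'cV[R]_m) v :
  uniq I -> (forall i, i \in I -> (i < tau)%N) -> (nexp R m N <= N)%N ->
  (\sum_(i <- I) c i ^+ 2) * (2 / Num.sqrt N%:R * dotv u u) <= v ->
  subgaussian P v (fun w => \sum_(i <- I) c i *
    dotv (residue_avg m (nexp R m N) (fun t => eta i t w)) u).
Proof.
move=> uI It nN cv; pose b t := \sum_(k < m | (k : nat) == (t %% m)%N)
  (residue_count (nexp R m N) k)%:R^-1 * u k 0.
have -> : (fun w => \sum_(i <- I) c i *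
    dotv (residue_avg m (nexp R m N) (fun t => eta i t w)) u) =
    (fun w => \sum_(i <- I) \sum_(0 <= t < nexp R m N) c i * b t * eta i t w).
  apply/funext => w; apply: eq_bigr => i _; rewrite residue_avg_dot mulr_sumr.
  by apply: eq_bigr => t _; rewrite mulrA.
apply: noise_subgaussian noise uI It nN _; apply: le_trans cv.
rewrite mulr_suml; apply: ler_sum => i _.
under eq_bigr do rewrite exprMn.
by rewrite -mulr_sumr ler_wpM2l ?sqr_ge0// residue_avg_variance.
Qed.

Lemma avg_sqr_uexp m i : (i < tau)%N -> (nexp R m N <= N)%N ->
  let z w := residue_avg m (nexp R m N) (fun t => eta i t w) in
  uexp P (fun w => dotv (z w) (z w)) (32 * (m%:R / Num.sqrt N%:R)).
Proof.
move=> it nN z; have sN : 0 < Num.sqrt N%:R :> R by rewrite sqrtr_gt0 ltr0n.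
have zk (k : 'I_m) : uexp P (fun w => z w k 0 ^+ 2) (16 * (2 / Num.sqrt N%:R)).
  apply: subgaussian_sqr; first by rewrite divr_gt0.
  have e1 : dotv (delta_mx k 0 : 'cV[R]_m) (delta_mx k 0) = 1.
    by rewrite dotvE (bigD1 k)//= big1 ?mxE ?eqxx ?mulr1 ?addr0// => j jk; rewrite !mxE (negbTE jk) mul0r.
  have := @avg_subgaussian m [:: i] (fun=> 1) (delta_mx k 0) (2 / Num.sqrt N%:R).
  rewrite big_seq1 expr1n mul1r e1 mulr1 => h.
  have -> : (fun w => z w k 0) = (fun w => \sum_(j <- [:: i]) 1 *
      dotv (residue_avg m (nexp R m N) (fun t => eta j t w)) (delta_mx k 0)).
    apply/funext => w; rewrite big_seq1 mul1r dotvE (bigD1 k)//= big1 ?addr0.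
      by rewrite [delta_mx _ _ _ _]mxE !eqxx mulr1.
    by move=> j jk; rewrite [delta_mx _ _ _ _]mxE (negbTE jk) mulr0.
  by apply: h => // j; rewrite inE => /eqP ->.
apply: uexp_le (uexp_sum (s := index_enum 'I_m) (Q := predT) (fun k _ _ => zk k)).
  by move=> w; rewrite dotvE; apply: ler_sum => k _; rewrite expr2.
rewrite sumr_const card_ord -[leLHS]mulr_natr.
by rewrite le_eqVlt; apply/orP; left; apply/eqP; ring.
Qed.

(** At two net vectors of squared norm at most 4 the bilinear form of [E] has variance proxy 4 * 4 *
    2 / sqrt N = 32 / sqrt N, and the product net has at most exp ((d + M) lam) points; the factor
    16 of [subgaussian_max] makes 512. The maximum over the net dominates the norm itself, because
    rounding never decreases the form. *)
Lemma noise_opnorm d (A0 : 'M[R]_d) (I : seq nat) M lam :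
  uniq I -> (forall i, i \in I -> (i < tau)%N) -> (nexp R d N <= N)%N ->
  size I = M -> (0 < M)%N -> (0 < d)%N -> A0^T *m A0 = 1%:M ->
  1 <= lam -> (2 * d).+1%:R <= expR lam -> (2 * M).+1%:R <= expR lam ->
  let E w : 'M[R]_(d, M) := \matrix_(k, j)
    (A0 *m residue_avg d (nexp R d N) (fun t => eta (nth 0%N I j) t w)) k 0 in
  exists g : T -> R, uexp P g (512 * ((d%:R + M%:R) * lam / Num.sqrt N%:R)) /\
    forall w, 0 <= g w /\
      forall y, dotv ((E w)^T *m y) ((E w)^T *m y) <= g w * dotv y y.
Proof.
move=> uI It nN sI M0 d0 AA lam1 dl Ml E.
have sN : 0 < Num.sqrt N%:R :> R by rewrite sqrtr_gt0 ltr0n.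
have AA' := mulmx1C AA.
pose z i w := residue_avg d (nexp R d N) (fun t => eta i t w).
pose o0 : 'I_M := Ordinal M0.
pose F := ({ffun 'I_d -> 'I_(2 * d).+1} * {ffun 'I_M -> 'I_(2 * M).+1})%type.
pose S : pred F := fun f => (dotv (grid_vec f.1) (grid_vec f.1) <= 4) &&
  (dotv (grid_vec f.2) (grid_vec f.2) <= 4).
(* The second grid vector, read at task indices instead of column numbers; [o0] is only the default
   of [insubd]. *)
pose c (f : F) i := grid_vec f.2 (insubd o0 (index i I)) 0.
pose X f w := \sum_(i <- I) c f i * dotv (z i w) (grid_vec f.1).
have cE f (o : 'I_M) : c f (nth 0%N I o) = grid_vec f.2 o 0.
  by rewrite /c index_uniq ?sI// valKd.
have XE f w : X f w = \sum_(o < M) grid_vec f.2 o 0 * dotv (z (nth 0%N I o) w) (grid_vec f.1).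
  rewrite /X (big_nth 0%N) sI big_mkord; apply: eq_bigr => o _; by rewrite cE.
pose l := (d%:R + M%:R) * lam.
have dM1 : 1 <= d%:R + M%:R :> R by rewrite -natrD ler1n addn_gt0 d0.
have l1 : 1 <= l.
  by apply: (le_trans lam1); rewrite /l ler_peMl// (le_trans ler01 lam1).
have cardS : #|S|%:R <= expR l.
  apply: (@le_trans _ _ #|{: F}|%:R); first by rewrite ler_nat max_card.
  rewrite card_prod !card_ffun !card_ord natrM !natrX /l mulrDl expRD.
  by apply: ler_pM; rewrite ?exprn_ge0// expRM_natl; apply: lerXn2r; rewrite ?nnegrE ?expR_ge0.
have [|f fS|g [ug hg]] := @subgaussian_max _ _ _ P F S X (32 / Num.sqrt N%:R) l _ l1 cardS.
- by rewrite divr_gt0.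
- move: fS; rewrite unfold_in /S => /andP[f1 f2]; apply: avg_subgaussian => //.
  have -> : \sum_(i <- I) c f i ^+ 2 = dotv (grid_vec f.2) (grid_vec f.2).
    rewrite (big_nth 0%N) sI big_mkord dotvE; apply: eq_bigr => o _; by rewrite cE expr2.
  apply: (@le_trans _ _ (4 * (2 / Num.sqrt N%:R * 4))).
    have s0 : 0 <= 2 / Num.sqrt N%:R :> R by rewrite divr_ge0// ltW.
    by apply: ler_pM => //; rewrite ?dotv_ge0 ?mulr_ge0 ?dotv_ge0// ler_wpM2l.
  by rewrite le_eqVlt; apply/orP; left; apply/eqP; ring.
exists g; split.
  apply: uexp_le ug => //.
  by rewrite le_eqVlt; apply/orP; left; apply/eqP; rewrite /l; ring.
move=> w; have [g0 h] := hg w; split=> // y.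
have [y0|yn] := eqVneq y 0; first by rewrite y0 mulmx0 !dotv0l mulr0.
have yp : 0 < dotv y y.
  by rewrite lt_neqAle dotv_ge0 andbT eq_sym; apply: contra_neq yn; exact: dotv_eq0.
have ny : 0 < vnorm y by rewrite sqrtr_gt0.
set q := (E w)^T *m y.
have [q0|qn] := eqVneq q 0; first by rewrite q0 dotv0l mulr_ge0// ltW.
have qp : 0 < dotv q q.
  by rewrite lt_neqAle dotv_ge0 andbT eq_sym; apply: contra_neq qn; exact: dotv_eq0.
have nq : 0 < vnorm q by rewrite sqrtr_gt0.
pose u := (vnorm y)^-1 *: (A0^T *m y); pose v := (vnorm q)^-1 *: q.
have u1 : dotv u u <= 1.
  rewrite /u dotvZl dotvZr dotv_orth ?trmxK// -vnorm_sqr.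
  by rewrite le_eqVlt; apply/orP; left; apply/eqP; field; rewrite gt_eqF.
have v1 : dotv v v <= 1.
  rewrite /v dotvZl dotvZr -vnorm_sqr.
  by rewrite le_eqVlt; apply/orP; left; apply/eqP; field; rewrite gt_eqF.
have qE o : q o 0 = vnorm y * dotv (z (nth 0%N I o) w) u.
  rewrite /u dotvZr mulVKf ?gt_eqF// -dotv_mull /q mxE dotvE.
  by apply: eq_bigr => k _; rewrite !mxE.
(* The order matters: [v] is rounded against [q], then [u] against the combination [b] formed with
   the rounded [v]. *)
have [f2 [f24 vf2]] := grid_vec_round q M0 v1.
pose b := \sum_(o < M) grid_vec f2 o 0 *: z (nth 0%N I o) w.
have [f1 [f14 uf1]] := grid_vec_round b d0 u1.
have dot_sum x : dotv b x = \sum_(o < M) grid_vec f2 o 0 * dotv (z (nth 0%N I o) w) x.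
  rewrite /b (big_morph (fun s => dotv s x) (fun s t => dotvDl s t x) (dotv0l x)).
  by apply: eq_bigr => o _; rewrite dotvZl.
have key : vnorm q / vnorm y <= X (f1, f2) w.
  rewrite XE /= -dot_sum dotvC; apply: le_trans uf1; rewrite dotvC dot_sum.
  rewrite ler_pdivrMr//.
  have -> : vnorm q = dotv v q by rewrite /v dotvZl -vnorm_sqr expr2 mulKf ?gt_eqF.
  apply: le_trans vf2 _; rewrite dotvE mulr_suml le_eqVlt; apply/orP; left; apply/eqP.
  by apply: eq_bigr => o _; rewrite qE; ring.
have := h (vnorm q / vnorm y) _ _; rewrite expr_div_n !vnorm_sqr ler_pdivrMr//; apply.
- by exists (f1, f2) => //; rewrite unfold_in /S /= f14.
- by rewrite divr_ge0 ?vnorm_ge0.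
Qed.

End NoiseOperatorNorm.

(** * Regret per task and in total *)

Section Regret.
Context {R : realType}.

(** Turns the singular value hypothesis on one window into a bound on a quadratic form, which can be
    added up over windows. *)
Lemma sigma_window {d r} (theta : nat -> 'cV[R]_d) (B : 'M[R]_(d, r)) s L nu (z : 'cV[R]_r) :
  B^T *m B = 1%:M -> (forall j, (j < L)%N -> exists a : 'cV[R]_r, theta (s + j)%N = B *m a) ->
  0 < nu -> (0 < r)%N ->
  nu <= sigma r (Wmat theta s L *m (Wmat theta s L)^T) ->
  nu * dotv z z <= \sum_(0 <= j < L) dotv (theta (s + j)%N) (B *m z) ^+ 2.
Proof.
move=> BB thB nu0 r0; set W := Wmat theta s L => sr.
have BW : B *m B^T *m W = W.
  apply/matrixP => k j; have [a ha] := thB j (ltn_ord j).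
  have cW : col j W = B *m a by rewrite -ha; apply/matrixP => i l; rewrite !mxE (ord1 l).
  have : col j (B *m B^T *m W) = col j W.
    by rewrite colE -mulmxA -colE cW mulmxA -(mulmxA B) BB mulmx1.
  by move=> /matrixP/(_ k 0); rewrite !mxE.
apply: le_trans (sigma_lower (P := W *m W^T) z _ _ BB _ nu0 r0 sr) _.
- by rewrite trmx_mul trmxK.
- by move=> x; rewrite -mulmxA dotv_mulr dotv_ge0.
- by rewrite mulmxA BW.
rewrite -mulmxA dotv_mulr dotvE big_mkord le_eqVlt; apply/orP; left; apply/eqP.
apply: eq_bigr => j _; rewrite -expr2; congr (_ ^+ 2).
by rewrite mxE dotvE; apply: eq_bigr => k _; rewrite !mxE.
Qed.

Lemma task_regret {d} (th : 'cV[R]_d) (a : nat -> 'cV[R]_d) n N delta phi :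
  0 < vnorm th -> vnorm th <= phi -> 0 <= delta -> (n <= N)%N ->
  (forall t, (t < n)%N -> vnorm (a t) <= 1) ->
  (forall t, (n <= t)%N -> dotv (opt_action th) th - dotv (a t) th <= delta) ->
  \sum_(t < N) (dotv (opt_action th) th - dotv (a t) th) <= n%:R * (2 * phi) + N%:R * delta.
Proof.
move=> th0 thphi d0 nN ha hd.
rewrite -(big_mkord predT (fun t => dotv (opt_action th) th - dotv (a t) th)).
rewrite (big_cat_nat (n := n))//=; apply: lerD.
  rewrite -[n in n%:R]subn0 mulr_natl -sumr_const_nat; apply: ler_sum_nat => t /andP[_ tn].
  by apply: le_trans (explore_gap th0 (ha t tn)) _; rewrite ler_wpM2l.
apply: (@le_trans _ _ (\sum_(n <= t < N) delta)).
  by apply: ler_sum_nat => t /andP[nt _]; exact: hd.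
rewrite sumr_const_nat -[leLHS]mulr_natl; apply: ler_wpM2r => //.
by rewrite ler_nat leq_subr.
Qed.

Context {dsp : measure_display} {T : measurableType dsp}.
Context (P : probability T R) (tau N : nat) (eta : nat -> nat -> T -> R).
Context (d r L : nat) (B : 'M[R]_(d, r)) (theta : nat -> 'cV[R]_d).
Context (A0 : 'M[R]_d) (topr : 'M[R]_d -> 'M[R]_(d, r))
  (basisRT : 'M[R]_(d, r) -> 'M[R]_(d, r)) (amax : 'cV[R]_d -> 'cV[R]_d).
Context (phimin phimax nu : R).
Context (phimin0 : 0 < phimin) (nu0 : 0 < nu) (BB : B^T *m B = 1%:M)
  (thetaB : forall i, (i < tau)%N -> exists alpha : 'cV[R]_r, theta i = B *m alpha)
  (thetaN : forall i, (i < tau)%N -> phimin <= vnorm (theta i) <= phimax)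
  (sigmaW : forall s, (s + L <= tau)%N ->
     nu <= sigma r (Wmat theta s L *m (Wmat theta s L)^T))
  (noise : noise_model P tau N eta) (AA : A0^T *m A0 = 1%:M)
  (toprP : forall Pm : 'M[R]_d, top_sv_spec Pm (topr Pm))
  (basisP : forall Bh : 'M[R]_(d, r), Bh^T *m Bh = 1%:M -> basis_spec Bh (basisRT Bh))
  (amaxP : is_argmax_selector amax) (nN : (nexp R d N <= N)%N)
  (N0 : (0 < N)%N) (L0 : (0 < L)%N) (r0 : (0 < r)%N) (tau0 : (0 < tau)%N).

Let sN : 0 < Num.sqrt N%:R :> R. Proof. by rewrite sqrtr_gt0 ltr0n. Qed.

Let d_ge_r : (r <= d)%N.
Proof.
have : (\rank (1%:M : 'M[R]_r) <= d)%N.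
  by rewrite -BB (leq_trans (mxrankM_maxr _ _)) // rank_leq_row.
by rewrite mxrank1.
Qed.

Let gap i w t := dotv (opt_action (theta i)) (theta i)
  - dotv (seq_action N L A0 topr basisRT amax theta (fun i t => eta i t w) i t) (theta i).

Let z m i w := residue_avg m (nexp R m N) (fun t => eta i t w).

Let count_gt0 m (k : 'I_m) : (0 < residue_count (nexp R m N) k)%N.
Proof.
by rewrite -(ltr_nat R); apply: lt_le_trans (residue_count_ge k N0); rewrite divr_gt0.
Qed.

(** Exploration lasts at most 2 d sqrt N rounds at 2 phimax each; the at most N remaining rounds
    cost 2 / phimin times the squared error, whose mean is at most 32 d / sqrt N. *)
Lemma RE_task_regret i : (i < tau)%N -> is_RE L i ->
  uexp P (fun w => \sum_(t < N) gap i w t)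
    ((4 * phimax + 64 / phimin) * (d%:R * Num.sqrt N%:R)).
Proof.
move=> it RE; have /andP[th1 th2] := thetaN it.
have th0 : 0 < vnorm (theta i) by exact: lt_le_trans th1.
have p0 : 0 <= phimax by apply: le_trans th2; exact: vnorm_ge0.
have d0 : (0 < d)%N by exact: leq_trans d_ge_r.
have c1 : 0 <= (nexp R d N)%:R * (2 * phimax) by rewrite !mulr_ge0.
have c2 : 0 <= N%:R * (2 / phimin) by rewrite mulr_ge0// divr_ge0// ltW.
apply: uexp_le (uexpD (uexp_cst P c1) (uexpZ c2 (avg_sqr_uexp noise N0 it nN))).
  move=> w /=; rewrite -/(z d i w) -mulrA.
  apply: task_regret => //.
  - by rewrite mulr_ge0 ?dotv_ge0// divr_ge0// ltW.
  - by move=> t tn; rewrite /seq_action RE /RE_action tn; exact: cyc_col_norm.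
  move=> t tn; rewrite /seq_action RE /RE_action ltnNge tn /=.
  apply: le_trans (argmax_gap _ amaxP th0) _.
  rewrite (RE_est_error _ _ AA (@count_gt0 d)) addrC addKr (dotv_orth _ _ AA) -/(z d i w).
  rewrite [leRHS]mulrAC; apply: ler_pM => //; rewrite ?invr_ge0 ?mulr_ge0 ?dotv_ge0 ?vnorm_ge0//.
  by rewrite lef_pV2.
have sE : N%:R = Num.sqrt N%:R * Num.sqrt N%:R :> R by rewrite -expr2 sqr_sqrtr.
have := nexp_le (R := R) d0 N0 => /(ler_wpM2r (mulr_ge0 (ler0n _ 2) p0)) h.
apply: le_trans (lerD h (lexx _)) _; rewrite le_eqVlt; apply/orP; left; apply/eqP.
set q := Num.sqrt N%:R in sE *; rewrite sE.
by field; rewrite !gt_eqF//; exact: sN.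
Qed.

Lemma estimated_projection i : (i < tau)%N -> ~~ is_RE L i -> forall lam,
  1 <= lam -> (2 * d).+1%:R <= expR lam -> (2 * tau).+1%:R <= expR lam ->
  let Bh w := (seq_state N L A0 topr theta (fun i t => eta i t w) i).2 in
  let n := (sched L i).1 in
  uexp P (fun w => dotv (theta i - Bh w *m ((Bh w)^T *m theta i))
                        (theta i - Bh w *m ((Bh w)^T *m theta i)))
    (4 * phimax ^+ 2 / (nu * n%:R) *
      (512 * ((d%:R + n%:R * L%:R) * lam / Num.sqrt N%:R))).
Proof.
move=> it RT lam lam1 dlam tlam Bh n.
have d0 : (0 < d)%N by exact: leq_trans d_ge_r.
have [n0 _ _] := schedP i L0; rewrite -/n in n0.
pose s := [seq j <- index_iota 0 i | is_RE L j]; pose M := (n * L)%N.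
have us : uniq s by rewrite filter_uniq// iota_uniq.
have sM : size s = M by exact: size_RE_tasks.
have M0 : (0 < M)%N by rewrite muln_gt0 n0.
have st j : j \in s -> (j < tau)%N.
  by rewrite mem_filter mem_index_iota => /andP[_ /= ji]; exact: ltn_trans it.
have Mtau : (2 * M).+1%:R <= expR lam.
  apply: le_trans tlam; rewrite ler_nat ltnS leq_mul2l/=.
  rewrite -sM (leq_trans _ (ltnW it))// /s -[X in (_ <= X)%N](size_iota 0 i) /index_iota subn0.
  by rewrite size_filter count_size.
have [g [ug hg]] := noise_opnorm noise N0 us st nN sM M0 d0 AA lam1 dlam Mtau.
have mu0 : 0 < nu * n%:R by rewrite mulr_gt0// ltr0n.
have c0 : 0 <= 4 * phimax ^+ 2 / (nu * n%:R).
  by rewrite divr_ge0 ?(ltW mu0)// mulr_ge0// sqr_ge0.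
apply: uexp_le (uexpZ c0 ug); last by rewrite natrM.
move=> w; have [g0 Ew] := hg w.
have /andP[_ thmax] := thetaN it.
pose Th : 'M[R]_(d, M) := \matrix_(k, j) theta (nth 0%N s j) k 0.
have thB (j : 'I_M) : exists alpha : 'cV[R]_r, theta (nth 0%N s j) = B *m alpha.
  by apply: thetaB; apply: st; apply: mem_nth; rewrite sM.
have BTh : B *m B^T *m Th = Th.
  apply/matrixP => k j; have [a ha] := thB j.
  have cTh : col j Th = B *m a by rewrite -ha; apply/matrixP => l m; rewrite !mxE (ord1 m).
  have : col j (B *m B^T *m Th) = col j Th.
    by rewrite colE -mulmxA -colE cTh mulmxA -(mulmxA B) BB mulmx1.
  by move=> /matrixP/(_ k 0); rewrite !mxE.
have [alpha thE] := thetaB it.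
have sum_s (V : nmodType) (f : nat -> V) :
    \sum_(j < M) f (nth 0%N s j) = \sum_(0 <= j < i | is_RE L j) f j.
  by rewrite -[RHS]big_filter -/s (big_nth 0%N) sM big_mkord.
(* At an RT task of cycle n, n RE blocks are complete; each is a window inside the first [tau] tasks
   and contributes [nu]. *)
have lower (y : 'cV[R]_r) : nu * n%:R * dotv y y <=
    dotv (Th^T *m (B *m y)) (Th^T *m (B *m y)).
  have -> : dotv (Th^T *m (B *m y)) (Th^T *m (B *m y)) =
      \sum_(0 <= j < i | is_RE L j) dotv (theta j) (B *m y) ^+ 2.
    rewrite -sum_s dotvE; apply: eq_bigr => j _; rewrite -expr2; congr (_ ^+ 2).
    by rewrite mxE dotvE; apply: eq_bigr => k _; rewrite !mxE.
  rewrite (RE_sum i _ L0) -/n.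
  rewrite (minn_idPr _); last by move: RT; rewrite /is_RE -leqNgt.
  rewrite -(@big_nat_recr _ _ _ n 1 (fun m => \sum_(0 <= j < L) dotv (theta (cycle_start L m + j)%N) (B *m y) ^+ 2))//=.
  apply: (@le_trans _ _ (\sum_(1 <= m < n.+1) nu * dotv y y)).
    by rewrite sumr_const_nat subSS subn0 -[leRHS]mulr_natr mulrAC.
  apply: ler_sum_nat => m /andP[m1 mn].
  have mt : (cycle_start L m + L <= tau)%N.
    apply: leq_trans (ltnW it); apply: leq_trans (RE_blocks_before L0 RT).
    by rewrite leq_add2r cycle_start_homo.
  apply: sigma_window => //; last exact: sigmaW.
  by move=> j jL; apply: thetaB; apply: leq_trans mt; rewrite ltn_add2l.
set E : 'M[R]_(d, M) := \matrix_(k, j) _ in Ew.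
have [stP stB] := seq_stateP N A0 topr theta (fun i t => eta i t w) i L0.
(* The columns of [Th + E] are the RE estimates, so the sum of their outer products is the matrix
   handed to [topr]. *)
have tB : top_sv_spec ((Th + E) *m (Th + E)^T) (Bh w).
  rewrite /Bh (stB RT); rewrite stP.
  have -> : \sum_(0 <= j < i | is_RE L j) RE_est N A0 (theta j) (fun t => eta j t w) *m
      (RE_est N A0 (theta j) (fun t => eta j t w))^T = (Th + E) *m (Th + E)^T.
    rewrite -sum_s; apply/matrixP => k l; rewrite summxE mxE; apply: eq_bigr => j _.
    rewrite (RE_est_error _ _ AA (@count_gt0 d)) mxE big_ord1 !mxE.
    by [].
  exact: toprP.
have := projection_error alpha BB BTh tB Ew mu0 lower; rewrite -thE => h.
apply: le_trans h _; rewrite -vnorm_sqr.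
rewrite [leRHS]mulrAC ler_pM2r ?invr_gt0// [leRHS]mulrAC.
rewrite ler_wpM2l ?mulr_ge0// ler_pXn2r// nnegrE ?vnorm_ge0//.
exact: le_trans (vnorm_ge0 _) thmax.
Qed.

(** The second term is N (2 / phimin) times the bound on the missed component: 8 is 2 * 4, the 512
    comes from the noise norm, and (d + n L) / n leaves d / n + L. *)
Lemma RT_task_regret i lam : (i < tau)%N -> ~~ is_RE L i ->
  1 <= lam -> (2 * d).+1%:R <= expR lam -> (2 * tau).+1%:R <= expR lam ->
  uexp P (fun w => \sum_(t < N) gap i w t)
    ((4 * phimax + 64 / phimin) * (r%:R * Num.sqrt N%:R) +
     8 * 512 * phimax ^+ 2 / (phimin * nu) *
       (lam * Num.sqrt N%:R * (d%:R / (sched L i).1%:R + L%:R))).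
Proof.
move=> it RT lam1 dlam tlam; have /andP[th1 th2] := thetaN it.
have th0 : 0 < vnorm (theta i) by exact: lt_le_trans th1.
have p0 : 0 <= phimax by apply: le_trans th2; exact: vnorm_ge0.
have rN : (nexp R r N <= N)%N by apply: leq_trans nN; exact: nexp_mono.
have c1 : 0 <= (nexp R r N)%:R * (2 * phimax) by rewrite !mulr_ge0.
have c2 : 0 <= N%:R * (2 / phimin) by rewrite mulr_ge0// divr_ge0// ltW.
have pe := estimated_projection it RT lam1 dlam tlam.
apply: uexp_le (uexpD (uexp_cst P c1)
  (uexpZ c2 (uexpD pe (avg_sqr_uexp noise N0 it rN)))).
  move=> w /=; rewrite -/(z r i w) -mulrA.
  set Bh := (seq_state _ _ _ _ _ _ i).2.
  have BhBh : Bh^T *m Bh = 1%:M.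
    have [_ stB] := seq_stateP N A0 topr theta (fun i t => eta i t w) i L0.
    by rewrite /Bh (stB RT); have [] := toprP (seq_state N L A0 topr theta (fun i t => eta i t w) i).1.
  have bs := basisP BhBh.
  apply: task_regret => //.
  - by rewrite mulr_ge0 ?addr_ge0 ?dotv_ge0// divr_ge0// ltW.
  - move=> t tn; rewrite /seq_action (negbTE RT) /RT_action tn.
    by apply: cyc_col_norm => //; case: bs.
  move=> t tn; rewrite /seq_action (negbTE RT) /RT_action ltnNge tn /= -/Bh.
  apply: le_trans (argmax_gap _ amaxP th0) _.
  rewrite (RT_est_error_sqr _ _ BhBh bs (@count_gt0 r)) -/(z r i w).
  rewrite [leRHS]mulrAC; apply: ler_pM => //;
    rewrite ?invr_ge0 ?mulr_ge0 ?addr_ge0 ?dotv_ge0 ?vnorm_ge0//.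
  by rewrite lef_pV2.
have sE : N%:R = Num.sqrt N%:R * Num.sqrt N%:R :> R by rewrite -expr2 sqr_sqrtr.
have [n0 _ _] := schedP i L0; have np : 0 < (sched L i).1%:R :> R by rewrite ltr0n.
have := nexp_le (R := R) r0 N0 => /(ler_wpM2r (mulr_ge0 (ler0n _ 2) p0)) h.
apply: le_trans (lerD h (lexx _)) _; rewrite le_eqVlt; apply/orP; left; apply/eqP.
set n := (_.1)%:R in np *; set q := Num.sqrt N%:R in sE *; rewrite sE.
by field; rewrite !gt_eqF//; exact: sN.
Qed.

(** Charging K1 + K2 to both kinds of task makes every bound affine in [task_weight], so the
    schedule enters only through [task_weight_sum]. *)
Lemma total_regret lam :
  1 <= lam -> (2 * d).+1%:R <= expR lam -> (2 * tau).+1%:R <= expR lam ->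
  uexp P (fun w => regret tau N L A0 topr basisRT amax theta (fun i t => eta i t w))
    ((4 * phimax + 64 / phimin + 8 * 512 * phimax ^+ 2 / (phimin * nu)) *
     (lam * Num.sqrt N%:R * (d%:R * (2 * (L%:R * (sched L tau).1%:R)) + tau%:R * (r%:R + L%:R)))).
Proof.
move=> lam1 dlam tlam.
set K1 := 4 * phimax + _; set K2 := 8 * 512 * _ / _.
have p0 : 0 <= phimax.
  by have /andP[_] := thetaN tau0; apply: le_trans; exact: vnorm_ge0.
have pm0 := ltW phimin0.
have K10 : 0 <= K1 by apply: addr_ge0; [exact: mulr_ge0|exact: divr_ge0].
have K20 : 0 <= K2.
  apply: divr_ge0; last by apply: mulr_ge0 => //; exact: ltW.
  by apply: mulr_ge0; [rewrite -natrM; exact: ler0n|exact: sqr_ge0].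
have l0 : 0 <= lam by exact: le_trans lam1.
have task i : (i < tau)%N -> uexp P (fun w => \sum_(t < N) gap i w t)
    ((K1 + K2) * (lam * Num.sqrt N%:R * (d%:R * task_weight L i + (r%:R + L%:R)))).
  move=> it; rewrite /task_weight.
  have ls : Num.sqrt N%:R <= lam * Num.sqrt N%:R by rewrite ler_peMl// ltW.
  have ls0 : 0 <= lam * Num.sqrt N%:R by rewrite mulr_ge0// ltW.
  have [n0 _ _] := schedP i L0.
  have dn0 : 0 <= d%:R / (sched L i).1%:R :> R by rewrite divr_ge0.
  case: ifPn => RE.
    apply: uexp_le (RE_task_regret it RE) => //; rewrite -/K1.
    have s0 := ltW sN.
    apply: ler_pM; [by []|exact: mulr_ge0|by rewrite lerDl|].
    rewrite mulrC mulr1; apply: ler_pM; [by []|by []|by []|].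
    by rewrite lerDl addr_ge0.
  apply: uexp_le (RT_task_regret it RE lam1 dlam tlam) => //; rewrite -/K1 -/K2 [leRHS](mulrDl K1 K2).
  apply: lerD; apply: ler_wpM2l => //.
    rewrite mulrC; apply: ler_pM; [exact: ltW|by []|by []|].
    by have := ler0n R L; lra.
  by apply: ler_wpM2l; [by []|have := ler0n R r; lra].
apply: uexp_le (uexp_sum (s := index_enum 'I_tau) (Q := predT)
  (fun (i : 'I_tau) _ _ => task i (ltn_ord i))); first by [].
have ls0 : 0 <= lam * Num.sqrt N%:R by rewrite mulr_ge0// ltW.
rewrite -mulr_sumr; apply: ler_wpM2l; first by rewrite addr_ge0.
rewrite -mulr_sumr; apply: ler_wpM2l => //.
rewrite big_split /= -mulr_sumr sumr_const card_ord -[_ *+ tau]mulr_natl lerD2r.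
apply: ler_wpM2l => //; apply: le_trans (task_weight_sum tau L0).
by rewrite big_mkord.
Qed.

End Regret.

(** Let s = sqrt (tau r) and let n be the cycle reached. The n - 1 finished cycles give L (n - 1)^2
    <= 2 tau, hence (L (n - 1))^2 <= 2 c1 s^2 <= ((1 + 2 c1) s)^2. The cycle in progress adds L = c1
    r <= c1 s, where r <= s follows from r^2 < tau. *)
Lemma exploration_weight_bound (R : realType) (c1 : R) (r tau L : nat) :
  0 < c1 -> (0 < L)%N -> L%:R = c1 * r%:R -> (r ^ 2 < tau)%N ->
  L%:R * (sched L tau).1%:R <= (1 + 3 * c1) * Num.sqrt (tau%:R * r%:R) /\
  r%:R + L%:R <= (1 + c1) * r%:R.
Proof.
move=> c10 L0 LE rt; split; last by rewrite LE; lra.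
set s := Num.sqrt _; have s0 : 0 <= s by exact: sqrtr_ge0.
have sE : s ^+ 2 = tau%:R * r%:R by rewrite sqr_sqrtr// mulr_ge0.
have rs : r%:R <= s.
  rewrite -(ler_pXn2r (n := 2))// ?nnegrE// sE expr2 -!natrM ler_nat leq_mul2r.
  by apply/orP; right; apply: leq_trans (ltnW rt); rewrite -mulnn; case: (r) => // k; rewrite leq_pmulr.
have [n0 _ tE] := schedP tau L0; set n := (sched L tau).1 in n0 tE *.
have nE : n%:R = 1 + n.-1%:R :> R by rewrite addrC natr1 prednK.
have Ln : (L%:R * n.-1%:R) ^+ 2 <= ((1 + 2 * c1) * s) ^+ 2 :> R.
  have h : L%:R * n.-1%:R ^+ 2 <= 2 * tau%:R :> R.
    rewrite -natrX -!natrM ler_nat; apply: leq_trans (cycle_start_ge L n.-1) _.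
    by rewrite prednK// leq_mul2l /= [leqRHS]tE leq_addr.
  rewrite !exprMn sE [L%:R ^+ 2]expr2 -mulrA.
  apply: (@le_trans _ _ (L%:R * (2 * tau%:R))); first by rewrite ler_wpM2l.
  rewrite LE (_ : c1 * r%:R * _ = 2 * c1 * (tau%:R * r%:R)); last by ring.
  by rewrite ler_wpM2r ?mulr_ge0//; nra.
have {}Ln : L%:R * n.-1%:R <= (1 + 2 * c1) * s.
  by move: Ln; rewrite ler_pXn2r// nnegrE mulr_ge0//; lra.
rewrite nE mulrDr mulr1 {1}LE.
have := ler_wpM2l (ltW c10) rs; lra.
Qed.

(** The factor 2 before the logarithm squares its argument, and 2 m + 1 <= (x + 2)^2 for m <= x. The
    other bound is ln 2 >= 1/2, obtained from exp (- 1/2) >= 1/2. *)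
Lemma log_dominates (R : realType) (d tau N m : nat) :
  (0 < d)%N -> (0 < tau)%N -> (0 < N)%N -> (m <= d * tau * N)%N ->
  1 <= 2 * ln (d%:R * tau%:R * N%:R + 2) :> R /\
  (2 * m).+1%:R <= expR (2 * ln (d%:R * tau%:R * N%:R + 2)) :> R.
Proof.
move=> d0 t0 N0 mle; rewrite -!natrM; set x := (_ * _)%N in mle *.
have x2 : 2 <= x%:R + 2 :> R by rewrite lerDr.
have xp : 0 < x%:R + 2 :> R by lra.
have eE : expR (ln (x%:R + 2)) = x%:R + 2 :> R by rewrite lnK// posrE.
split.
  have : 1 / 2 <= ln (x%:R + 2) :> R; last by lra.
  rewrite -ler_expR eE.
  have h : 1 - 1 / 2 <= expR (- (1 / 2)) :> R by have := expR_ge1Dx (- (1 / 2) : R); lra.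
  have := expR_gt0 (1 / 2 : R).
  have : expR (1 / 2) * expR (- (1 / 2)) = 1 :> R by rewrite expRxMexpNx_1.
  nra.
by rewrite (expRM_natl 2) eE -natrD -natrX ler_nat -mulnn; nia.
Qed.

(** [C] and [k] are chosen before all dimensions, which makes the O-tilde uniform in them. [topr],
    [basisRT] and [amax] range over all selectors meeting their specifications, so any way of
    breaking ties is covered. *)
Theorem theorem2 (R : realType) (c1 phimin phimax nu : R) :
  0 < c1 -> 0 < phimin -> phimin <= phimax -> 0 < nu ->
  exists (C : R) (k : nat), 0 < C /\
  forall (d r tau N L : nat) (B : 'M[R]_(d, r)) (theta : nat -> 'cV[R]_d)
    (dsp : measure_display) (T : measurableType dsp) (P : probability T R)
    (eta : nat -> nat -> T -> R)
    (A0 : 'M[R]_d) (topr : 'M[R]_d -> 'M[R]_(d, r))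
    (basisRT : 'M[R]_(d, r) -> 'M[R]_(d, r)) (amax : 'cV[R]_d -> 'cV[R]_d),
  B^T *m B = 1%:M ->
  (forall i, (i < tau)%N -> exists alpha : 'cV[R]_r, theta i = B *m alpha) ->
  (forall i, (i < tau)%N -> phimin <= vnorm (theta i) <= phimax) ->
  (r ^ 2 < tau)%N ->
  L%:R = c1 * r%:R ->
  (forall s, (s + L <= tau)%N ->
     nu <= sigma r (Wmat theta s L *m (Wmat theta s L)^T)) ->
  noise_model P tau N eta ->
  A0^T *m A0 = 1%:M ->
  (forall Pm : 'M[R]_d, top_sv_spec Pm (topr Pm)) ->
  (forall Bh : 'M[R]_(d, r), Bh^T *m Bh = 1%:M -> basis_spec Bh (basisRT Bh)) ->
  is_argmax_selector amax ->
  (nexp R d N <= N)%N ->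
  (\int[P]_w (regret tau N L A0 topr basisRT amax theta
                 (fun i t => eta i t w))%:E
   <= (C * (ln (d%:R * tau%:R * N%:R + 2)) ^+ k
        * (d%:R * Num.sqrt (tau%:R * r%:R * N%:R)
           + tau%:R * r%:R * Num.sqrt N%:R))%:E)%E.
Proof.
move=> c10 phimin0 phis nu0.
have phimax0 : 0 < phimax by exact: lt_le_trans phis.
pose K := 4 * phimax + 64 / phimin + 8 * 512 * phimax ^+ 2 / (phimin * nu).
have K0 : 0 < K.
  apply: addr_gt0; first by apply: addr_gt0; [exact: mulr_gt0|exact: divr_gt0].
  apply: divr_gt0; last exact: mulr_gt0.
  by apply: mulr_gt0; [rewrite -natrM ltr0n muln_gt0|exact: exprn_gt0].
have C0 : 0 < 4 * (1 + 3 * c1) * K by rewrite mulr_gt0// mulr_gt0//; lra.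
(* One factor 2 comes from lam = 2 l, and 2 (1 + 3 c1) bounds both the exploration weight and (r +
   L) / r. *)
exists (4 * (1 + 3 * c1) * K), 1%N; split => //.
move=> d r tau N L B theta dsp T P eta A0 topr basisRT amax BB thB thN rt LE sW noise AA
  toprP basisP amaxP nN.
have tau0 : (0 < tau)%N by exact: leq_ltn_trans rt.
(* For r = 0 every task vector would be 0, against the lower bound [phimin > 0] on its norm. *)
have r0 : (0 < r)%N.
  rewrite lt0n; apply/eqP => r00; have [alpha th0] := thB 0%N tau0.
  have /andP[] := thN 0%N tau0; rewrite th0 leNgt (_ : B *m alpha = 0) ?/vnorm ?dotv0l ?sqrtr0 ?phimin0//.
  apply/matrixP => i j; rewrite !mxE big1// => k; by have := ltn_ord k; rewrite {2}r00.
have d0 : (0 < d)%N.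
  rewrite lt0n; apply/eqP => d00; have /andP[] := thN 0%N tau0.
  rewrite leNgt /vnorm dotvE big1 ?sqrtr0 ?phimin0// => k.
  by have := ltn_ord k; rewrite {2}d00.
have L0 : (0 < L)%N by rewrite -(ltr_nat R) LE mulr_gt0// ltr0n.
rewrite expr1.
have [N00|N0] := posnP N.
  under eq_integral => w _.
    rewrite (_ : regret _ _ _ _ _ _ _ _ _ = 0); last first.
      by rewrite /regret big1// => i _; rewrite big1// => t; have := ltn_ord t; rewrite {2}N00.
    over.
  rewrite integral0 lee_fin; apply: mulr_ge0; last first.
    by apply: addr_ge0; apply: mulr_ge0; rewrite ?mulr_ge0 ?sqrtr_ge0.
  by apply: mulr_ge0; [exact: ltW|rewrite ln_ge0// N00 mulr0; lra].
have [lam1 dlam] := log_dominates R (m := d) d0 tau0 N0 ltac:(by rewrite -mulnA leq_pmulr// muln_gt0 tau0).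
have [_ tlam] := log_dominates R (m := tau) d0 tau0 N0 ltac:(by rewrite mulnAC leq_pmull// muln_gt0 d0).
set l := ln _ in lam1 dlam tlam *.
apply: uexp_integral.
apply: uexp_le (total_regret phimin0 nu0 BB thB thN sW noise AA toprP basisP amaxP nN
  N0 L0 r0 tau0 lam1 dlam tlam) => //; rewrite -/K.
have [h1 h2] := exploration_weight_bound c10 L0 LE rt.
have s0 : 0 <= Num.sqrt N%:R :> R by exact: sqrtr_ge0.
rewrite [Num.sqrt (_ * N%:R)]sqrtrM ?mulr_ge0//.
set s := Num.sqrt (_ * r%:R) in h1 *; set q := Num.sqrt N%:R in s0 *.
set w := L%:R * _ in h1 *; set dd := d%:R; set tt := tau%:R; set rr := r%:R in h2 *.
have ss0 : 0 <= s by exact: sqrtr_ge0.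
have a1 : dd * (2 * w) <= 2 * (1 + 3 * c1) * (dd * s).
  have := ler_wpM2l (ler0n R d) h1; rewrite -/dd; lra.
have a2 : tt * (rr + L%:R) <= 2 * (1 + 3 * c1) * (tt * rr).
  have := ler_wpM2l (ler0n R tau) h2; rewrite -/tt.
  have : 0 <= tt * rr by rewrite mulr_ge0.
  have := ltW c10; nra.
have lq : 0 <= 2 * l * q by rewrite mulr_ge0//; lra.
have := ler_wpM2l lq (lerD a1 a2) => /(ler_wpM2l (ltW K0)) h.
by apply: (le_trans h); rewrite le_eqVlt; apply/orP; left; apply/eqP; ring.
Qed.
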